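(* Let $a\in\mathcal P$ be an element of antighost number $i>0$ satisfying $\delta a=0$. Then there exists $b\in\mathcal P$ (of antighost number $i+1$) such that $a=\delta b$. In other words, the homology $H_i(\delta)$ of the covariant Koszul–Tate differential $\delta$ vanishes for all antighost numbers $i>0$.
   Context: Spacetime is $\mathbb R^n$ with the Minkowski metric, used to raise and lower spacetime indices $\mu,\nu,\dots$. $G$ is a simple Lie group with Lie algebra basis indices $a,b,c$ and structure constants $C^a_{bc}$; internal indices are moved with an invariant nondegenerate metric, so that $C_{abc}$ is totally antisymmetric. $\lambda$ is a real coupling constant. The Chapline–Manton model has fields $A^a_\mu$ and $B_{\mu\nu}=-B_{\nu\mu}$, with $F^a_{\mu\nu}=\partial_\mu A^a_\nu-\partial_\nu A^a_\mu-C^a_{bc}A^b_\mu A^c_\nu$ and $H_{\mu\nu\rho}=\partial_\mu B_{\nu\rho}+\partial_\nu B_{\rho\mu}+\partial_\rho B_{\mu\nu}-2\lambda C_{abc}A^a_\mu A^b_\nu A^c_\rho-2\lambda(A^a_\mu F_{a\nu\rho}+A^a_\nu F_{a\rho\mu}+A^a_\rho F_{a\mu\nu})$, and Lagrangian $-\frac14F^a_{\mu\nu}F_a^{\mu\nu}-\frac1{12}H_{\mu\nu\rho}H^{\mu\nu\rho}$. One adds ghosts $C^a$ (Grassmann odd), $\eta_\mu$ (odd), $\rho$ (even) and antifields $A^{*\mu}_a$ (odd), $C^*_a$ (even), $B^{*\mu\nu}=-B^{*\nu\mu}$ (odd), $\eta^{*\mu}$ (even), $\rho^*$ (odd). $\mathcal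 P$ is the algebra of spacetime exterior forms whose coefficients are polynomials in all these variables and their partial derivatives of all orders. $D_\mu$ is the gauge covariant derivative in the adjoint representation, $D_\mu X^a=\partial_\mu X^a-C^a_{bc}A^b_\mu X^c$ (indices moved with the invariant metric). The differential $\delta$ is the odd derivation of $\mathcal P$ commuting with $\partial_\mu$ defined by: $\delta$ vanishes on $A^a_\mu,B_{\mu\nu},C^a,\eta_\mu,\rho$; $\delta B^{*\mu\nu}=\partial_\rho H^{\rho\mu\nu}$, $\delta\eta^{*\mu}=-\partial_\nu B^{*\nu\mu}$, $\delta\rho^*=-\partial_\mu\eta^{*\mu}$, $\delta A^{*\mu}_a=D_\nu F_a^{\nu\mu}+2\lambda H^{\mu\nu\rho}F_{a\nu\rho}$, $\delta C^*_a=2\lambda B^{*\mu\nu}F_{a\mu\nu}-D_\mu A^{*\mu}_a$. The antighost number is the grading with: fields and ghosts $0$; $A^{*\mu}_a$ and $B^{*\mu\nu}$: $1$; $C^*_a$ and $\eta^{*\mu}$: $2$; $\rho^*$: $3$ ($\delta$ lowers it by one).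
   Formalization: The spacetime dimension is assumed to be n ≥ 3; for n ≤ 2 the field strength H vanishes identically and the claim fails (for n = 2, B^{*01} is a δ-cycle that is not a boundary). *)

(* Defs.v *)
From HB Require Import structures.
From mathcomp Require Import all_boot all_order all_algebra.
From mathcomp Require Import reals.
Set Implicit Arguments. Unset Strict Implicit. Unset Printing Implicit Defensive.
Import Order.TTheory GRing.Theory Num.Theory.
Local Open Scope ring_scope.

(* ordered pairs (mu,nu) with mu < nu : independent components of an
   antisymmetric 2-tensor *)
Notation pairlt n := {p : 'I_n * 'I_n | (p.1 < p.2)%N}.

(* The undifferentiated fields, ghosts and antifields.
   Index conventions: bA a mu = A^a_mu ; bB (mu,nu) = B_{mu nu} (mu<nu) ;
   bC a = C^a ; beta mu = eta_mu ; brho = rho ;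
   bAs a mu = A^{* mu}_a ; bCs a = C^*_a ; bBs (mu,nu) = B^{* mu nu} (mu<nu) ;
   betas mu = eta^{* mu} ; brhos = rho^* . *)
Inductive base (n N : nat) :=
| bA of 'I_N & 'I_n
| bB of pairlt n
| bC of 'I_N
| beta of 'I_n
| brho
| bAs of 'I_N & 'I_n
| bCs of 'I_N
| bBs of pairlt n
| betas of 'I_n
| brhos.
Arguments brho {n N}. Arguments brhos {n N}.
Arguments bA {n N}. Arguments bB {n N}. Arguments bC {n N}. Arguments beta {n N}.
Arguments bAs {n N}. Arguments bCs {n N}. Arguments bBs {n N}. Arguments betas {n N}.

Definition base_code (n N : nat) :=
  (('I_N * 'I_n) + pairlt n + 'I_N + 'I_n + unit + ('I_N * 'I_n) + 'I_N
   + pairlt n + 'I_n + unit)%type.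

Definition base_enc n N (b : base n N) : base_code n N :=
  match b with
  | bA a m => inl (inl (inl (inl (inl (inl (inl (inl (inl (a, m)))))))))
  | bB p => inl (inl (inl (inl (inl (inl (inl (inl (inr p))))))))
  | bC a => inl (inl (inl (inl (inl (inl (inl (inr a)))))))
  | beta m => inl (inl (inl (inl (inl (inl (inr m))))))
  | brho => inl (inl (inl (inl (inl (inr tt)))))
  | bAs a m => inl (inl (inl (inl (inr (a, m)))))
  | bCs a => inl (inl (inl (inr a)))
  | bBs p => inl (inl (inr p))
  | betas m => inl (inr m)
  | brhos => inr tt
  end.

Definition base_dec n N (x : base_code n N) : base n N :=
  match x with
  | inl (inl (inl (inl (inl (inl (inl (inl (inl (a, m))))))))) => bA a m
  | inl (inl (inl (inl (inl (inl (inl (inl (inr p)))))))) => bB p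
  | inl (inl (inl (inl (inl (inl (inl (inr a))))))) => bC a
  | inl (inl (inl (inl (inl (inl (inr m)))))) => beta m
  | inl (inl (inl (inl (inl (inr _))))) => brho
  | inl (inl (inl (inl (inr (a, m))))) => bAs a m
  | inl (inl (inl (inr a))) => bCs a
  | inl (inl (inr p)) => bBs p
  | inl (inr m) => betas m
  | inr _ => brhos
  end.

Lemma base_encK n N : cancel (@base_enc n N) (@base_dec n N).
Proof. by case. Qed.

HB.instance Definition _ n N := Countable.copy (base n N) (can_type (@base_encK n N)).

(* Generators of the free graded-commutative algebra P:
   Gf b I = the multi-derivative  d^I b  (I : multi-index, I mu = number of
   derivatives d_mu), and Gdx mu = the spacetime one-form dx^mu. *)
Inductive gen (n N : nat) :=
| Gf of base n N & {ffun 'I_n -> nat}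
| Gdx of 'I_n.
Arguments Gf {n N}. Arguments Gdx {n N}.

Definition gen_enc n N (g : gen n N) : (base n N * {ffun 'I_n -> nat}) + 'I_n :=
  match g with Gf b J => inl (b, J) | Gdx m => inr m end.
Definition gen_dec n N (x : (base n N * {ffun 'I_n -> nat}) + 'I_n) : gen n N :=
  match x with inl (b, J) => Gf b J | inr m => Gdx m end.
Lemma gen_encK n N : cancel (@gen_enc n N) (@gen_dec n N).
Proof. by case. Qed.
HB.instance Definition _ n N := Countable.copy (gen n N) (can_type (@gen_encK n N)).

Definition base_odd n N (b : base n N) : bool :=
  match b with
  | bC _ | beta _ | bAs _ _ | bBs _ | brhos => true
  | _ => false
  end.
Definition gen_odd n N (g : gen n N) : bool :=
  match g with Gf b _ => base_odd b | Gdx _ => true end.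

Definition base_agh n N (b : base n N) : nat :=
  match b with
  | bAs _ _ | bBs _ => 1
  | bCs _ | betas _ => 2
  | brhos => 3
  | _ => 0
  end%N.
Definition gen_agh n N (g : gen n N) : nat :=
  match g with Gf b _ => base_agh b | Gdx _ => 0%N end.

Section Algebra.
Variables (R : realType) (n N : nat).

(* A word is a (non-commutative) product of generators; an element of P is
   represented by a formal linear combination of words. *)
Definition word := seq (gen n N).
Definition Pelt := seq (R * word).

Definition word_agh (w : word) : nat := sumn (map (@gen_agh n N) w).

(* Normal form in the free graded-commutative algebra: sort the word by a
   fixed total order on generators; the sign is (-1)^(number of inversions
   between odd generators); a word with a repeated odd generator is 0. *)
Definition gkey (g : gen n N) : nat := pickle g.
Definition sortw (w : word) : word := sort (fun x y => (gkey x <= gkey y)%N) w.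
Fixpoint oddinv (w : word) : nat :=
  match w with
  | [::] => 0%N
  | g :: w' =>
      ((if gen_odd g then count (fun h => gen_odd h && (gkey h < gkey g)%N) w'
        else 0) + oddinv w')%N
  end.

Definition pcoef (p : Pelt) (m : word) : R :=
  \sum_(x <- p)
    (if uniq (filter (@gen_odd n N) x.2) && (sortw x.2 == m)
     then (-1) ^+ oddinv x.2 * x.1 else 0).

Definition peq (p q : Pelt) : Prop := forall m, pcoef p m = pcoef q m.
Definition has_agh (i : nat) (p : Pelt) : Prop :=
  forall m, word_agh m != i -> pcoef p m = 0.

Definition pvar (g : gen n N) : Pelt := [:: (1, [:: g])].
Definition pscale (c : R) (p : Pelt) : Pelt := [seq (c * x.1, x.2) | x <- p].
Definition pneg (p : Pelt) : Pelt := pscale (-1) p.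
Definition pmul (p q : Pelt) : Pelt :=
  [seq (x.1 * y.1, x.2 ++ y.2) | x <- p, y <- q].
Definition psum (I : finType) (f : I -> Pelt) : Pelt :=
  flatten [seq f i | i <- enum I].

(* total derivative d_mu : the even derivation with d_mu (d^I phi) = d^(I+mu) phi
   and d_mu dx^nu = 0 *)
Definition I0 : {ffun 'I_n -> nat} := [ffun _ => 0%N].
Definition incr (I : {ffun 'I_n -> nat}) (mu : 'I_n) : {ffun 'I_n -> nat} :=
  [ffun nu => (I nu + (nu == mu))%N].
Definition tder_gen (mu : 'I_n) (g : gen n N) : option (gen n N) :=
  match g with Gf b J => Some (Gf b (incr J mu)) | Gdx _ => None end.
Fixpoint tderw (mu : 'I_n) (w : word) : Pelt :=
  match w with
  | [::] => [::]
  | g :: w' =>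
      (if tder_gen mu g is Some g' then [:: (1, g' :: w')] else [::])
      ++ [seq (x.1, g :: x.2) | x <- tderw mu w']
  end.
Definition tder (mu : 'I_n) (p : Pelt) : Pelt :=
  flatten [seq pscale x.1 (tderw mu x.2) | x <- p].
Definition tderI (I : {ffun 'I_n -> nat}) (p : Pelt) : Pelt :=
  foldr (fun mu q => iter (I mu) (tder mu) q) p (enum 'I_n).

Definition fA (a : 'I_N) (mu : 'I_n) : Pelt := pvar (Gf (bA a mu) I0).
Definition fAs (a : 'I_N) (mu : 'I_n) : Pelt := pvar (Gf (bAs a mu) I0).
Definition fetas (mu : 'I_n) : Pelt := pvar (Gf (betas mu) I0).
Definition antisym_comp (mk : pairlt n -> base n N) (mu nu : 'I_n) : Pelt :=
  (if (insub (mu, nu) : option (pairlt n)) is Some q then pvar (Gf (mk q) I0)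
   else [::])
  ++ pneg (if (insub (nu, mu) : option (pairlt n)) is Some q
           then pvar (Gf (mk q) I0) else [::]).
Definition fB := antisym_comp bB.
Definition fBs := antisym_comp bBs.

Variables (C : 'I_N -> 'I_N -> 'I_N -> R) (* C a b c = C^a_{bc} *)
          (k : 'M[R]_N)
          (lam : R).

Definition mink (mu : 'I_n) : R := if (val mu == 0)%N then -1 else 1.

Definition Clo (a b c : 'I_N) : R := \sum_d k a d * C d b c.

Definition fF (a : 'I_N) (mu nu : 'I_n) : Pelt :=
  tder mu (fA a nu) ++ pneg (tder nu (fA a mu))
  ++ pneg (psum (fun bc : 'I_N * 'I_N =>
                   pscale (C a bc.1 bc.2) (pmul (fA bc.1 mu) (fA bc.2 nu)))).
Definition fFlo (a : 'I_N) (mu nu : 'I_n) : Pelt :=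
  psum (fun b => pscale (k a b) (fF b mu nu)).
Definition fFup (a : 'I_N) (mu nu : 'I_n) : Pelt :=
  pscale (mink mu * mink nu) (fFlo a mu nu).

Definition fH (mu nu rho : 'I_n) : Pelt :=
  tder mu (fB nu rho) ++ tder nu (fB rho mu) ++ tder rho (fB mu nu)
  ++ pscale (-2 * lam)
       (psum (fun abc : 'I_N * 'I_N * 'I_N =>
          pscale (Clo abc.1.1 abc.1.2 abc.2)
            (pmul (fA abc.1.1 mu) (pmul (fA abc.1.2 nu) (fA abc.2 rho)))))
  ++ pscale (-2 * lam)
       (psum (fun a => pmul (fA a mu) (fFlo a nu rho)
                       ++ pmul (fA a nu) (fFlo a rho mu)
                       ++ pmul (fA a rho) (fFlo a mu nu))).
Definition fHup (mu nu rho : 'I_n) : Pelt :=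
  pscale (mink mu * mink nu * mink rho) (fH mu nu rho).

Definition raise (X : 'I_N -> Pelt) (b : 'I_N) : Pelt :=
  psum (fun d => pscale (invmx k b d) (X d)).
(* covariant derivative of a family X_a with lower internal index:
   D_nu X_a = k_{ab} D_nu X^b,  D_nu X^b = d_nu X^b - C^b_{cd} A^c_nu X^d *)
Definition covD (nu : 'I_n) (X : 'I_N -> Pelt) (a : 'I_N) : Pelt :=
  psum (fun b => pscale (k a b)
    (tder nu (raise X b)
     ++ pneg (psum (fun cd : 'I_N * 'I_N =>
                      pscale (C b cd.1 cd.2) (pmul (fA cd.1 nu) (raise X cd.2)))))).

Definition delta_base (b : base n N) : Pelt :=
  match b with
  | bAs a mu =>
      psum (fun nu => covD nu (fun c => fFup c nu mu) a)
      ++ pscale (2 * lam) (psum (fun nr : 'I_n * 'I_n =>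
                                   pmul (fHup mu nr.1 nr.2) (fFlo a nr.1 nr.2)))
  | bCs a =>
      pscale (2 * lam) (psum (fun mn : 'I_n * 'I_n =>
                                pmul (fBs mn.1 mn.2) (fFlo a mn.1 mn.2)))
      ++ pneg (psum (fun mu => covD mu (fun c => fAs c mu) a))
  | bBs q => psum (fun rho => tder rho (fHup rho (val q).1 (val q).2))
  | betas mu => pneg (psum (fun nu => tder nu (fBs nu mu)))
  | brhos => pneg (psum (fun mu => tder mu (fetas mu)))
  | _ => [::]
  end.

(* delta commutes with d_mu, vanishes on dx *)
Definition delta_gen (g : gen n N) : Pelt :=
  match g with Gf b J => tderI J (delta_base b) | Gdx _ => [::] end.

Definition gsign (g : gen n N) : R := if gen_odd g then -1 else 1.

Fixpoint deltaw (w : word) : Pelt :=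
  match w with
  | [::] => [::]
  | g :: w' =>
      [seq (x.1, x.2 ++ w') | x <- delta_gen g]
      ++ pscale (gsign g) [seq (x.1, g :: x.2) | x <- deltaw w']
  end.
Definition delta (p : Pelt) : Pelt :=
  flatten [seq pscale x.1 (deltaw x.2) | x <- p].

End Algebra.

Section Lie.
Variables (R : realType) (N : nat) (C : 'I_N -> 'I_N -> 'I_N -> R).

Definition lie_bracket (x y : 'I_N -> R) : 'I_N -> R :=
  fun a => \sum_b \sum_c C a b c * x b * y c.

Definition lie_structure_constants : Prop :=
  (forall a b c, C a b c = - C a c b) /\
  (forall a b c d, \sum_e (C a b e * C e c d + C a c e * C e d b
                           + C a d e * C e b c) = 0).

Definition lie_ideal (I : ('I_N -> R) -> Prop) : Prop :=
  [/\ I (fun _ => 0),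
      (forall x y, I x -> I y -> I (fun a => x a + y a)),
      (forall r x, I x -> I (fun a => r * x a)) &
      (forall x y, I x -> I (lie_bracket x y))].

Definition simple_lie : Prop :=
  (exists x y a, lie_bracket x y a != 0) /\
  (forall I, lie_ideal I -> (forall x, I x -> forall a, x a = 0) \/ (forall x, I x)).

Definition invariant_metric (k : 'M[R]_N) : Prop :=
  [/\ k^T = k, k \in unitmx,
      (forall a b c, Clo C k a b c = - Clo C k b a c) &
      (forall a b c, Clo C k a b c = - Clo C k a c b)].
End Lie.

(* Main.v *)
Require Import Defs.
From HB Require Import structures.
From mathcomp Require Import all_boot all_order all_algebra.
From mathcomp Require Import reals.
From mathcomp Require Import boolp zify.
Set Implicit Arguments. Unset Strict Implicit. Unset Printing Implicit Defensive.
Import GRing.Theory Num.Theory.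
Local Open Scope ring_scope.

(** The classes of formal combinations of words modulo [peq] form a graded-commutative
    algebra [Q], on which [delta] and the total derivatives act as graded derivations;
    [delta] squares to zero by the Bianchi identities.  Order the generators by a weight
    for which [delta g] has a leading part that is linear in a single kind of generator,
    every other term being strictly lighter.  The weight is multiplicative in the
    derivatives and favours the directions 0, 1, 2, in this order, so that the leading
    parts match each antifield generator bijectively (up to the metric [k]) with another
    generator, e.g. [d^J C^*] with [d_0 d^J A^{*0}] and [d^J A^{*i}] with [d_0^2 d^J A_i];
    this is where [3 <= n] is needed.  Inverting the leading parts defines an odd
    derivation [s], and [delta s + s delta] acts on a monomial as multiplication by the
    number of its matched generators, up to lighter terms.  In positive antighost number
    this number is positive, and induction on the weight shows that cycles are
    boundaries. *)

(** The equations of motion are nonlinear, and the contraction must work at every differential order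
    at once. A weight multiplicative in the derivatives and additive over the letters of a word
    settles both. Applied to a product, [d^J] spreads its derivatives over the factors and costs at
    most the factor [cJ J], so estimates are needed only for undifferentiated expressions; and a
    product of low derivatives is lighter than one letter carrying second derivatives. The Noether
    identities shape the matching. Component 0 of the equation of [A] has no second time derivative,
    so its antifield is matched with [d_0 d_1 A_1]; the time derivative of this component follows
    from the other equations up to lighter terms, which frees [d_0 A^{*0}] to be the partner of
    [C^*]. The 2-form repeats this with two further layers, [eta^*] and [rho^*]. A cycle cannot be
    divided outright by an eigenvalue, since [delta s + s delta] is diagonal only up to lighter
    terms and its eigenvalues vary. Instead the words with most matched letters are removed one
    count at a time, each time by a correction that is a boundary. *)

Local Open Scope quotient_scope.

(** * The free graded-commutative algebra *)

Section NormalForm.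
Variables (R : realType) (n N : nat).
Notation G := (gen n N).
Notation W := (word n N).
Notation P := (Pelt R n N).
Implicit Types (g h : G) (u v w : W) (p q : P).

Definition sgn (b : bool) : R := (-1) ^+ b.

Lemma sgnD a b : sgn (a (+) b) = sgn a * sgn b.
Proof. by rewrite /sgn signr_addb. Qed.

Lemma sgn_odd i : (-1) ^+ i = sgn (odd i).
Proof. by rewrite /sgn signr_odd. Qed.

Lemma gkey_inj : injective (@gkey n N).
Proof. exact: (pcan_inj pickleK). Qed.

Notation lekey := (fun x y : G => gkey x <= gkey y)%N.

Lemma lekey_total : total lekey. Proof. by move=> x y; exact: leq_total. Qed.
Lemma lekey_trans : transitive lekey. Proof. by move=> x y z; exact: leq_trans. Qed.
Lemma lekey_anti : antisymmetric lekey.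
Proof. by move=> x y /= H; apply: gkey_inj; apply/eqP; rewrite eqn_leq. Qed.

Lemma sortw_id w : sorted lekey w -> sortw w = w.
Proof. exact: (sorted_sort lekey_trans). Qed.

Lemma perm_sortw u v : perm_eq u v -> sortw u = sortw v.
Proof. by move/(perm_sortP lekey_total lekey_trans lekey_anti). Qed.

Lemma sortw_perm w : perm_eq (sortw w) w.
Proof. by rewrite /sortw perm_sort. Qed.

Lemma perm_swap u g h v : perm_eq (u ++ g :: h :: v) (u ++ h :: g :: v).
Proof. by rewrite perm_cat2l -cat1s -(cat1s h) -(cat1s h (g :: v)) -(cat1s g v) perm_catCA. Qed.

Definition uniq_odd w := uniq (filter (@gen_odd n N) w).

Lemma perm_uniq_odd u v : perm_eq u v -> uniq_odd u = uniq_odd v.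
Proof. by move=> H; apply: perm_uniq; apply: perm_filter. Qed.

(** The factor relating a word to its sorted form, as isolated from [pcoef]; see [gcomm_sort]. *)
Definition nsgn w : R := if uniq_odd w then (-1) ^+ oddinv w else 0.

Section Universal.
Variable V : lmodType R.
(** Functions of words obeying this exchange rule are those that descend to the quotient by [peq].
    Repeated odd generators need no separate clause: exchanging two equal odd neighbours gives
    [x = - x]. *)
Definition gcomm (phi : W -> V) := forall u g h v,
  phi (u ++ g :: h :: v) = sgn (gen_odd g && gen_odd h) *: phi (u ++ h :: g :: v).

Lemma gcomm_cons phi g : gcomm phi -> gcomm (fun w => phi (g :: w)).
Proof. by move=> H u; apply: (H (g :: u)). Qed.

Lemma eq_opp0 (x : V) : x = - x -> x = 0.
Proof.
move=> H; have: (2%:R : R) *: x = 0 by rewrite scaler_nat mulr2n {1}H addNr.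
by move/eqP; rewrite scaler_eq0 pnatr_eq0 /= => /eqP.
Qed.

(** Cost of moving [g] rightwards to its place in a sorted word: for odd [g], one sign per smaller
    odd letter crossed. *)
Definition insgn g w : R :=
  if gen_odd g then
    if g \in w then 0
    else (-1) ^+ count (fun h => gen_odd h && (gkey h < gkey g)%N) w
  else 1.

Lemma gcomm_insert phi : gcomm phi -> forall g w, sorted lekey w ->
  phi (g :: w) = insgn g w *: phi (sortw (g :: w)).
Proof.
move=> Hphi g w; elim: w phi Hphi => [|h w IH] phi Hphi Hs.
  by rewrite /insgn /= if_same scale1r sortw_id.
have Hall : all (lekey h) w by move: Hs => /=; rewrite path_sortedE // => [/andP[]|];
  last exact: lekey_trans.
have Hs' : sorted lekey w by move: Hs; apply: path_sorted.
have [lt_gh|lt_hg|] := ltngtP (gkey g) (gkey h).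
- rewrite sortw_id /= ?(ltnW lt_gh) //.
  rewrite /insgn; case: ifP => [odd_g|_]; last by rewrite scale1r.
  have Hc : forall x, x \in h :: w -> (gkey g < gkey x)%N.
    by move=> x; rewrite in_cons => /orP[/eqP->//|/(allP Hall)]; apply: leq_trans.
  rewrite ifN; last by apply/negP => /Hc; rewrite ltnn.
  rewrite (@eq_in_count _ _ pred0) ?count_pred0 ?scale1r // => x /Hc Hx /=.
  by rewrite ltnNge (ltnW Hx) andbF.
- rewrite (Hphi [::]) /= (IH _ (gcomm_cons h Hphi) Hs') scalerA.
  have -> : h :: sortw (g :: w) = sortw (g :: h :: w).
    rewrite -(@sortw_id (h :: _)) ?(perm_sortw (perm_swap [::] g h w)).
      by apply: perm_sortw; rewrite /= perm_cons sortw_perm.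
    rewrite /= path_sortedE; last exact: lekey_trans.
    rewrite sort_sorted ?andbT; last exact: lekey_total.
    by rewrite (perm_all _ (sortw_perm _)) /= (ltnW lt_hg).
  congr (_ *: _); rewrite /insgn; case odd_g: (gen_odd g); last by rewrite mulr1.
  rewrite in_cons; have -> /= : g == h = false.
    by apply: contraTF lt_hg => /eqP->; rewrite ltnn.
  case: ifP => _; first by rewrite mulr0.
  by rewrite lt_hg andbT exprD /sgn.
(* A repeated letter: if it is odd, exchanging it with itself forces the value to vanish. *)
- move/gkey_inj => eq_gh; subst h.
  case odd_g: (gen_odd g); last first.
    rewrite /insgn odd_g scale1r sortw_id //.
    by move: Hs => /= ->; rewrite leqnn.
  rewrite /insgn odd_g mem_head scale0r; apply: eq_opp0.
  by rewrite {1}(Hphi [::]) /= odd_g /sgn expr1 scaleN1r.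
Qed.

Lemma gcomm_sort phi : gcomm phi -> forall w, phi w = nsgn w *: phi (sortw w).
Proof.
move=> Hphi w; elim: w phi Hphi => [|g w IH] phi Hphi.
  by rewrite /nsgn /uniq_odd /= expr0 scale1r.
rewrite (IH _ (gcomm_cons g Hphi)) (gcomm_insert Hphi); last by apply: sort_sorted;
  exact: lekey_total.
have -> : sortw (g :: sortw w) = sortw (g :: w).
  by apply: perm_sortw; rewrite perm_cons sortw_perm.
rewrite scalerA; congr (_ *: _).
rewrite /nsgn /insgn /uniq_odd /=; case odd_g: (gen_odd g); last by rewrite mulr1.
rewrite (perm_mem (sortw_perm w)) /= mem_filter odd_g /=.
case: (g \in w) => /=; first by rewrite mulr0.
case: ifP => _; last by rewrite mul0r.
by rewrite mulrC exprD (permP (sortw_perm w)).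
Qed.

Definition linext (phi : W -> V) p : V := \sum_(x <- p) x.1 *: phi x.2.

Lemma linext_cat phi p q : linext phi (p ++ q) = linext phi p + linext phi q.
Proof. by rewrite /linext big_cat. Qed.

Lemma pcoefE p m :
  pcoef p m = \sum_(x <- p) (if sortw x.2 == m then nsgn x.2 * x.1 else 0).
Proof.
apply: eq_bigr => x _; rewrite /nsgn /uniq_odd.
by case: (uniq _); case: (sortw _ == m); rewrite //= mul0r.
Qed.

(** Shows that [linext] sees [p] only through its coefficients, hence is compatible with [peq]. The
    set [s] is a parameter so that two elements can be expanded over a common one. *)
Lemma linext_normal phi : gcomm phi -> forall (s : seq W) p,
  uniq s -> {subset [seq sortw x.2 | x <- p] <= s} ->
  linext phi p = \sum_(m <- s) pcoef p m *: phi m.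
Proof.
move=> Hphi s p Us sub.
under [RHS]eq_bigr => m _ do rewrite pcoefE scaler_suml.
rewrite exchange_big /=; apply: eq_big_seq => x xp.
rewrite (bigD1_seq (sortw x.2)) //=; last by apply: sub; apply: map_f.
rewrite eqxx big1 ?addr0; last by move=> m /negPf; rewrite eq_sym => ->; rewrite scale0r.
by rewrite (gcomm_sort Hphi) scalerA mulrC.
Qed.

Lemma linext_peq phi : gcomm phi -> forall p q, peq p q -> linext phi p = linext phi q.
Proof.
move=> Hphi p q Hpq.
set s := undup ([seq sortw x.2 | x <- p] ++ [seq sortw x.2 | x <- q]).
rewrite !(@linext_normal phi Hphi s) ?undup_uniq //.
- by under eq_bigr => m _ do rewrite Hpq.
- by move=> m mq; rewrite mem_undup mem_cat mq orbT.
- by move=> m mq; rewrite mem_undup mem_cat mq.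
Qed.
End Universal.

Lemma pcoef_cat p q m : pcoef (p ++ q) m = pcoef p m + pcoef q m.
Proof. by rewrite /pcoef big_cat. Qed.

Lemma pcoef_scale c p m : pcoef (pscale c p) m = c * pcoef p m.
Proof.
rewrite /pcoef big_map mulr_sumr; apply: eq_bigr => x _ /=.
by case: ifP => _; rewrite ?mulr0 // mulrCA.
Qed.

(** Exactly one of the two orders of distinct odd neighbours is an inversion, and all other pairs
    are unaffected; [uniq_odd] excludes the tie, where neither order is. *)
Lemma oddinv_swap u g h v : uniq_odd (u ++ g :: h :: v) ->
  odd (oddinv (u ++ g :: h :: v)) =
  (gen_odd g && gen_odd h) (+) odd (oddinv (u ++ h :: g :: v)).
Proof.
elim: u => [|f u IH] /=.
  move=> H; have {H} : uniq_odd [:: g; h].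
    move: H; rewrite /uniq_odd -[g :: _]/([:: g; h] ++ v) filter_cat cat_uniq.
    by case/andP.
  rewrite /uniq_odd /=; case og: (gen_odd g); case oh: (gen_odd h) => //=.
  rewrite inE andbT => neq_gh.
  have : (gkey g != gkey h) by apply: contra neq_gh => /eqP/gkey_inj->.
  rewrite !oddD; case: ltngtP => // _ _ /=; rewrite ?add0n ?add1n /=;
    case: (odd (count _ _)); case: (odd (count _ _)); case: (odd (oddinv v)) => //.
move=> H; have {}H : uniq_odd (u ++ g :: h :: v).
  by move: H; rewrite /uniq_odd /=; case: (gen_odd f) => //= /andP[].
rewrite !oddD IH // (permP (perm_swap u g h v)).
by case: (gen_odd f); rewrite // addbCA.
Qed.

Lemma pcoef_gcomm m : gcomm (fun w => pcoef [:: ((1 : R), w)] m : R^o).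
Proof.
move=> u g h v; rewrite /pcoef !big_seq1 /=.
rewrite -!/(uniq_odd _) (perm_sortw (perm_swap u g h v)) (perm_uniq_odd (perm_swap u g h v)).
case: ifP => [/andP[U _]|_]; last by rewrite scaler0.
rewrite !mulr1 !sgn_odd oddinv_swap ?sgnD // (perm_uniq_odd (perm_swap u g h v)) //.
Qed.

(** * The quotient by [peq] as a module *)

Definition peqb p q := `[< peq p q >].
Lemma peqb_refl : reflexive peqb. Proof. by move=> p; apply/asboolP. Qed.
Lemma peqb_sym : symmetric peqb.
Proof. by move=> p q; apply/asboolP/asboolP => H m; rewrite H. Qed.
Lemma peqb_trans : transitive peqb.
Proof. by move=> p q r /asboolP H1 /asboolP H2; apply/asboolP => m; rewrite H1 H2. Qed.

Definition peq_equiv := EquivRel peqb peqb_refl peqb_sym peqb_trans.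
Definition Q := {eq_quot peq_equiv}.
HB.instance Definition _ := EqQuotient.on Q.
HB.instance Definition _ := Choice.on Q.

Definition cl p : Q := \pi_Q p.

Lemma clP p q : cl p = cl q <-> peq p q.
Proof.
by split=> [/eqquotP/asboolP//|H]; apply/eqquotP/asboolP.
Qed.

Lemma cl_repr (x : Q) : cl (repr x) = x. Proof. exact: reprK. Qed.

Lemma pcoef_repr p m : pcoef (repr (cl p)) m = pcoef p m.
Proof. by move: m; apply/clP; rewrite cl_repr. Qed.

Definition addQ (x y : Q) : Q := cl (repr x ++ repr y).
Definition scaleQ (c : R) (x : Q) : Q := cl (pscale c (repr x)).

Lemma clDP p q : addQ (cl p) (cl q) = cl (p ++ q).
Proof. by apply/clP => m; rewrite !pcoef_cat !pcoef_repr. Qed.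
Lemma clZP c p : scaleQ c (cl p) = cl (pscale c p).
Proof. by apply/clP => m; rewrite !pcoef_scale !pcoef_repr. Qed.

Lemma Q_ind (S : Q -> Prop) : (forall p, S (cl p)) -> forall x, S x.
Proof. by move=> H x; rewrite -(cl_repr x). Qed.

Lemma addQA : associative addQ.
Proof. by elim/Q_ind=> p; elim/Q_ind=> q; elim/Q_ind=> r; rewrite !clDP catA. Qed.
Lemma addQC : commutative addQ.
Proof.
elim/Q_ind=> p; elim/Q_ind=> q; rewrite !clDP; apply/clP => m.
by rewrite !pcoef_cat addrC.
Qed.
Lemma add0Q : left_id (cl [::]) addQ.
Proof. by elim/Q_ind=> p; rewrite !clDP. Qed.
Lemma addNQ : left_inverse (cl [::]) (scaleQ (-1)) addQ.
Proof.
elim/Q_ind=> p; rewrite !clZP !clDP; apply/clP => m.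
by rewrite pcoef_cat pcoef_scale mulN1r addNr /pcoef big_nil.
Qed.
HB.instance Definition _ := GRing.isZmodule.Build Q addQA addQC add0Q addNQ.

Lemma clD p q : cl (p ++ q) = cl p + cl q. Proof. by rewrite -clDP. Qed.

Lemma scaleQA a b x : scaleQ a (scaleQ b x) = scaleQ (a * b) x.
Proof.
by move: x; elim/Q_ind=> p; rewrite !clZP; apply/clP=> m; rewrite !pcoef_scale mulrA.
Qed.
Lemma scale1Q : left_id 1 scaleQ.
Proof. by elim/Q_ind=> p; rewrite !clZP; apply/clP=> m; rewrite !pcoef_scale mul1r. Qed.
Lemma scaleQDr : right_distributive scaleQ +%R.
Proof.
move=> c; elim/Q_ind=> p; elim/Q_ind=> q; rewrite -clD !clZP -clD; apply/clP=> m.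
by rewrite !(pcoef_scale, pcoef_cat) mulrDr.
Qed.
Lemma scaleQDl x : {morph scaleQ^~ x : a b / a + b}.
Proof.
move: x; elim/Q_ind=> p a b; rewrite !clZP -clD; apply/clP=> m.
by rewrite !(pcoef_scale, pcoef_cat) mulrDl.
Qed.
HB.instance Definition _ :=
  GRing.Zmodule_isLmodule.Build R Q scaleQA scale1Q scaleQDr scaleQDl.

Lemma clZ c p : cl (pscale c p) = c *: cl p. Proof. by rewrite -clZP. Qed.

Definition mon w : Q := cl [:: (1, w)].

Lemma clE p : cl p = linext mon p.
Proof.
elim: p => [|[c w] p IH]; first by rewrite /linext big_nil.
rewrite /linext big_cons -/(linext _ _) -IH -cat1s clD /= -clZ /pscale /= mulr1 //.
Qed.

Lemma mon_gcomm : gcomm mon.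
Proof.
move=> u g h v; rewrite /mon -clZ; apply/clP=> m; rewrite pcoef_scale.
exact: (pcoef_gcomm m u g h v).
Qed.

Section Lift.
Variables (V : lmodType R) (phi : W -> V) (Hphi : gcomm phi).
Definition qlift of gcomm phi := fun x : Q => linext phi (repr x).
Lemma qlift_cl p : qlift Hphi (cl p) = linext phi p.
Proof. by apply: (linext_peq Hphi); apply/clP; rewrite cl_repr. Qed.
Lemma qlift_mon w : qlift Hphi (mon w) = phi w.
Proof. by rewrite qlift_cl /linext big_seq1 scale1r. Qed.
Lemma linextZ c p : linext phi (pscale c p) = c *: linext phi p.
Proof. by rewrite /linext big_map scaler_sumr; apply: eq_bigr => x _; rewrite scalerA. Qed.
Lemma qlift_linear : linear (qlift Hphi).
Proof.
move=> c; elim/Q_ind=> p; elim/Q_ind=> q.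
by rewrite -clZ -clD !qlift_cl linext_cat linextZ.
Qed.
HB.instance Definition _ := GRing.isLinear.Build R Q V _ (qlift Hphi) qlift_linear.
End Lift.

(** * The product on the quotient *)

Lemma gcomm_catl v : gcomm (fun w => mon (v ++ w)).
Proof. by move=> u g h w; rewrite !catA mon_gcomm -catA. Qed.
Lemma gcomm_catr v : gcomm (fun w => mon (w ++ v)).
Proof. by move=> u g h w; rewrite -!catA /= mon_gcomm. Qed.

Lemma cl_pmul p q : cl (pmul p q) = \sum_(x <- p) \sum_(y <- q) (x.1 * y.1) *: mon (x.2 ++ y.2).
Proof. by rewrite clE /linext /pmul big_allpairs_dep. Qed.

(** Multiplication by a fixed word, on either side, respects graded commutation, so the two factors
    can be replaced one at a time. *)
Lemma pmul_peq p p' q q' : peq p p' -> peq q q' -> cl (pmul p q) = cl (pmul p' q').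
Proof.
move=> Hp Hq; rewrite !cl_pmul.
transitivity (\sum_(x <- p) \sum_(y <- q') (x.1 * y.1) *: mon (x.2 ++ y.2)).
  apply: eq_bigr => x _.
  under eq_bigr do rewrite -scalerA; under [RHS]eq_bigr do rewrite -scalerA.
  rewrite -!scaler_sumr; congr (_ *: _).
  exact: (linext_peq (gcomm_catl x.2) Hq).
rewrite exchange_big [RHS]exchange_big /=; apply: eq_bigr => y _.
under eq_bigr do rewrite mulrC -scalerA; under [RHS]eq_bigr do rewrite mulrC -scalerA.
rewrite -!scaler_sumr; congr (_ *: _).
exact: (linext_peq (gcomm_catr y.2) Hp).
Qed.

Definition mulQ (x y : Q) : Q := cl (pmul (repr x) (repr y)).
Lemma clMP p q : mulQ (cl p) (cl q) = cl (pmul p q).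
Proof. by apply: pmul_peq; apply/clP; rewrite cl_repr. Qed.

Lemma mulQ_sum p q :
  mulQ (cl p) (cl q) = \sum_(x <- p) \sum_(y <- q) (x.1 * y.1) *: mon (x.2 ++ y.2).
Proof. by rewrite clMP cl_pmul. Qed.

Lemma mulQDl : left_distributive mulQ +%R.
Proof.
by elim/Q_ind=> p; elim/Q_ind=> q; elim/Q_ind=> r; rewrite -clD !mulQ_sum big_cat.
Qed.
Lemma mulQDr : right_distributive mulQ +%R.
Proof.
elim/Q_ind=> p; elim/Q_ind=> q; elim/Q_ind=> r; rewrite -clD !mulQ_sum -big_split /=.
by apply: eq_bigr => x _; rewrite big_cat.
Qed.
Lemma mulQZl c x y : c *: mulQ x y = mulQ (c *: x) y.
Proof.
move: x y; elim/Q_ind=> p; elim/Q_ind=> q; rewrite -(clZ c p) !mulQ_sum big_map scaler_sumr.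
by apply: eq_bigr => x _; rewrite scaler_sumr; apply: eq_bigr => y _; rewrite scalerA mulrA.
Qed.
Lemma mulQZr c x y : c *: mulQ x y = mulQ x (c *: y).
Proof.
move: x y; elim/Q_ind=> p; elim/Q_ind=> q; rewrite -(clZ c q) !mulQ_sum scaler_sumr.
apply: eq_bigr => x _; rewrite scaler_sumr big_map; apply: eq_bigr => y _.
by rewrite scalerA mulrCA.
Qed.

Lemma Q_span (S : Q -> Prop) : S 0 -> (forall c w x, S x -> S (c *: mon w + x)) ->
  forall x, S x.
Proof.
move=> S0 SD; elim/Q_ind=> p; rewrite clE /linext.
by elim: p => [|x p IH]; rewrite ?big_nil // big_cons; apply: SD.
Qed.

Lemma mulQ_mon u v : mulQ (mon u) (mon v) = mon (u ++ v).
Proof. by rewrite mulQ_sum !big_seq1 /= mulr1 scale1r. Qed.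

Lemma mul0Q x : mulQ 0 x = 0.
Proof. by rewrite -[0 in LHS](scale0r 0) -mulQZl scale0r. Qed.
Lemma mulQ0 x : mulQ x 0 = 0.
Proof. by rewrite -[0 in LHS](scale0r 0) -mulQZr scale0r. Qed.

Lemma mulQA : associative mulQ.
Proof.
elim/Q_span=> [|a u x IHx] y z; first by rewrite !mul0Q.
rewrite !mulQDl IHx -!mulQZl; congr (_ *: _ + _) => {x IHx}.
elim/Q_span: y z => [|b v y IHy] z; first by rewrite !(mul0Q, mulQ0).
rewrite !(mulQDl, mulQDr) IHy -!(mulQZl, mulQZr) -?mulQZl; congr (_ *: _ + _) => {y IHy}.
elim/Q_span: z => [|c w z IHz]; first by rewrite !mulQ0.
by rewrite !mulQDr IHz -!mulQZr !mulQ_mon catA.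
Qed.
Lemma mul1Q : left_id (mon [::]) mulQ.
Proof.
elim/Q_span=> [|c w z IHz]; first by rewrite !mulQ0.
by rewrite !mulQDr IHz -!mulQZr !mulQ_mon.
Qed.
Lemma mulQ1 : right_id (mon [::]) mulQ.
Proof.
elim/Q_span=> [|c w z IHz]; first by rewrite !mul0Q.
by rewrite !mulQDl IHz -!mulQZl !mulQ_mon cats0.
Qed.
Lemma Q1_neq0 : mon [::] != 0.
Proof.
apply/eqP => /clP/(_ [::]); rewrite /pcoef big_seq1 big_nil /= mulr1 expr0.
by move/eqP; rewrite oner_eq0.
Qed.
HB.instance Definition _ :=
  GRing.Zmodule_isNzRing.Build Q mulQA mul1Q mulQ1 mulQDl mulQDr Q1_neq0.
HB.instance Definition _ := GRing.Lmodule_isLalgebra.Build R Q mulQZl.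
HB.instance Definition _ := GRing.Lalgebra_isAlgebra.Build R Q mulQZr.

Lemma clM p q : cl (pmul p q) = cl p * cl q. Proof. by rewrite -clMP. Qed.
Lemma monM u v : mon (u ++ v) = mon u * mon v. Proof. by rewrite -mulQ_mon. Qed.
Definition gx g : Q := mon [:: g].
Lemma mon_cons g w : mon (g :: w) = gx g * mon w. Proof. by rewrite -monM. Qed.
Lemma mon_nil : mon [::] = 1. Proof. by []. Qed.
End NormalForm.

(** * Graded derivations *)

Arguments sgn {R}.
Arguments mon {R n N}.
Arguments gx {R n N}.

Lemma scale_swap (R : comNzRingType) (V : lmodType R) (a b : R) (v : V) :
  a *: (b *: v) = b *: (a *: v).
Proof. by rewrite !scalerA mulrC. Qed.

(** Cancellation of the cross terms [D1 g * D2 y] and [D2 g * D1 y] in the Leibniz rule for a graded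
    commutator. *)
Lemma bracket_cancel (V : zmodType) (a a' b b' e e' : V) :
  a + b + (b' + e) + (- a' - b' + (- b - e')) = a - a' + (e - e').
Proof.
rewrite addrACA [a + b + _]addrACA [b' + e + _]addrACA -addrA; congr (_ + _).
by rewrite addrA -[b' - b]opprB subrr add0r.
Qed.

Section Derivations.
Variables (R : realType) (n N : nat).
Notation G := (gen n N).
Notation W := (word n N).
Notation Q := (Q R n N).
Notation cl := (@cl R n N).
Implicit Types (g h : G) (u v w : W) (x y z : Q) (S T : pred W).

(** Only one representative is asked to have its words in [S], so no normal form intervenes and [S]
    may depend on the order of letters. Parity, degrees and weight bounds are all expressed this
    way. *)
Definition span S x := exists2 p, all (fun t => S t.2) p & x = cl p.

Lemma span0 S : span S 0.
Proof. by exists [::]. Qed.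

Lemma spanD S x y : span S x -> span S y -> span S (x + y).
Proof.
by move=> [p Hp ->] [q Hq ->]; exists (p ++ q); rewrite ?clD // all_cat Hp Hq.
Qed.

Lemma spanZ S c x : span S x -> span S (c *: x).
Proof.
by move=> [p Hp ->]; exists (pscale c p); rewrite ?clZ // /pscale all_map.
Qed.

Lemma spanN S x : span S x -> span S (- x).
Proof. by rewrite -scaleN1r; apply: spanZ. Qed.

Lemma spanB S x y : span S x -> span S y -> span S (x - y).
Proof. by move=> Hx Hy; apply: spanD => //; apply: spanN. Qed.

Lemma span_sum S (I : Type) (r : seq I) (K : pred I) (F : I -> Q) :
  (forall i, K i -> span S (F i)) -> span S (\sum_(i <- r | K i) F i).
Proof.
by move=> H; apply: (big_ind (span S)) => //; [apply: span0 | apply: spanD].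
Qed.

Lemma span_mon S w : S w -> span S (mon w).
Proof. by move=> Sw; exists [:: (1, w)] => //=; rewrite Sw. Qed.

Lemma sub_span S T x : subpred S T -> span S x -> span T x.
Proof. by move=> ST [p Hp ->]; exists p => //; apply: sub_all Hp => t; apply: ST. Qed.

Lemma span_ind S (K : Q -> Prop) : K 0 ->
  (forall c w x, S w -> K x -> K (c *: mon w + x)) -> forall x, span S x -> K x.
Proof.
move=> K0 KD _ [p Hp ->]; rewrite clE /linext.
elim: p Hp => [|t p IH] /=; first by rewrite big_nil.
by case/andP=> St /IH; rewrite big_cons; apply: KD.
Qed.

Lemma span_pred0 S x : S =1 pred0 -> span S x -> x = 0.
Proof. by move=> S0; move: x; apply: span_ind => // c w y; rewrite S0. Qed.

Lemma spanM S T (U : pred W) x y : (forall u v, S u -> T v -> U (u ++ v)) ->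
  span S x -> span T y -> span U (x * y).
Proof.
move=> H Sx Ty; move: x Sx; apply: span_ind => [|c u x Su Ux].
  by rewrite mul0r; apply: span0.
rewrite mulrDl; apply: spanD => //; rewrite -scalerAl; apply: spanZ => {x Ux}.
move: y Ty; apply: span_ind => [|d v y Tv Uy]; first by rewrite mulr0; apply: span0.
rewrite mulrDr -scalerAr -monM; apply: spanD => //; apply: spanZ.
by apply: span_mon; apply: H.
Qed.

Lemma span_linear (L : {linear Q -> Q}) S T x :
  (forall w, S w -> span T (L (mon w))) -> span S x -> span T (L x).
Proof.
move=> H; move: x; apply: span_ind => [|c w x Sw Tx]; first by rewrite linear0; apply: span0.
by rewrite linearP; apply: spanD => //; apply: spanZ; apply: H.
Qed.

(** * Parity and graded commutativity *)

Definition wodd w := odd (count (@gen_odd n N) w).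
Lemma wodd_cat u v : wodd (u ++ v) = wodd u (+) wodd v.
Proof. by rewrite /wodd count_cat oddD. Qed.
Lemma wodd_cons g w : wodd (g :: w) = gen_odd g (+) wodd w.
Proof. by rewrite -cat1s wodd_cat /wodd /= addn0; case: (gen_odd g). Qed.

Definition par e x := span (fun w => wodd w == e) x.

Lemma parM e e' x y : par e x -> par e' y -> par (e (+) e') (x * y).
Proof. by apply: spanM => u v /eqP<- /eqP<-; rewrite wodd_cat. Qed.

Lemma par_gx g : par (gen_odd g) (gx g).
Proof. by apply: span_mon; rewrite wodd_cons addbF. Qed.

Lemma gx_comm g h : gx g * gx h = sgn (gen_odd g && gen_odd h) *: (gx h * gx g) :> Q.
Proof. by rewrite -!mon_cons (mon_gcomm _ [::]). Qed.

Lemma gx_mon_comm g w : gx g * mon w = sgn (gen_odd g && wodd w) *: (mon w * gx g) :> Q.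
Proof.
elim: w => [|h w IH]; first by rewrite mon_nil mulr1 mul1r andbF scale1r.
rewrite mon_cons mulrA gx_comm -scalerAl -!mulrA IH -scalerAr scalerA.
by rewrite -sgnD wodd_cons andb_addr.
Qed.

Lemma mon_comm u w : mon u * mon w = sgn (wodd u && wodd w) *: (mon w * mon u) :> Q.
Proof.
elim: u => [|g u IH]; first by rewrite mon_nil mulr1 mul1r scale1r.
rewrite mon_cons -mulrA IH -scalerAr [gx g * (_ * _)]mulrA gx_mon_comm -scalerAl scalerA -!mulrA.
by rewrite -sgnD wodd_cons andb_addl addbC.
Qed.

Lemma par_comm e e' x y : par e x -> par e' y -> x * y = sgn (e && e') *: (y * x).
Proof.
move=> Hx Hy; move: x Hx; apply: span_ind => [|c u x /eqP<-]; first by rewrite mul0r mulr0 scaler0.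
rewrite mulrDl mulrDr scalerDr => ->; congr (_ + _) => {x}.
rewrite -scalerAl -scalerAr scale_swap; congr (_ *: _).
move: y Hy; apply: span_ind => [|d v y /eqP<-]; first by rewrite mul0r mulr0 scaler0.
rewrite mulrDl mulrDr scalerDr => ->; congr (_ + _) => {y}.
by rewrite -scalerAl -scalerAr scale_swap mon_comm.
Qed.

Lemma even_comm e x y : par false x -> par e y -> x * y = y * x.
Proof. by move=> Hx Hy; rewrite (par_comm Hx Hy) scale1r. Qed.

(** A graded derivation is stored as its parity and its values on generators. The parity condition
    on the values is what lets the Leibniz extension respect the exchange rule [gcomm]. *)
Record sder := Sder {
  spar : bool;
  sfun : G -> Q;
  sderP : forall g, par (spar (+) gen_odd g) (sfun g) }.

Fixpoint derw (D : sder) w : Q :=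
  if w is g :: w' then
    sfun D g * mon w' + sgn (spar D && gen_odd g) *: (gx g * derw D w')
  else 0.

Lemma derw_cat D u v : derw D (u ++ v) =
  derw D u * mon v + sgn (spar D && wodd u) *: (mon u * derw D v).
Proof.
elim: u => [|g u IH] /=; first by rewrite mul0r add0r andbF scale1r mon_nil mul1r.
rewrite IH monM mulrA mulrDl -addrA; congr (_ + _).
rewrite mulrDr scalerDr mulrA -!scalerAl; congr (_ + _).
rewrite -scalerAr scalerA mulrA -mon_cons; congr (_ *: _).
by rewrite -sgnD wodd_cons andb_addr.
Qed.

Lemma derw_swap D g h v :
  derw D (g :: h :: v) = sgn (gen_odd g && gen_odd h) *: derw D (h :: g :: v).
Proof.
have Hg := par_comm (par_gx h) (sderP D g).
have Hh := par_comm (par_gx g) (sderP D h).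
rewrite /= !(mon_cons _ g) !(mon_cons _ h) !mulrDr !scalerDr -!scalerAr !mulrA Hg Hh (gx_comm g h).
rewrite -!scalerAl !scalerA addrCA -!sgnD -[sfun D g * gx h * mon v in LHS]scale1r.
rewrite -[1]/(sgn false).
congr (_ *: _ + (_ *: _ + _ *: _)); congr sgn;
  by case: (spar D); case: (gen_odd g); case: (gen_odd h).
Qed.

Lemma derw_gcomm D : gcomm (derw D).
Proof.
move=> u g h v; rewrite !derw_cat derw_swap.
have -> : mon (g :: h :: v) = sgn (gen_odd g && gen_odd h) *: mon (h :: g :: v) :> Q.
  exact: (mon_gcomm _ [::]).
by rewrite [RHS]scalerDr -!scalerAr; congr (_ + _); rewrite scale_swap.
Qed.

Definition der D := qlift (derw_gcomm D).
HB.instance Definition _ D := GRing.Linear.on (der D).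

Lemma der_mon D w : der D (mon w) = derw D w.
Proof. exact: qlift_mon. Qed.
Lemma der_gx D g : der D (gx g) = sfun D g.
Proof. by rewrite der_mon /= mulr0 scaler0 addr0 mon_nil mulr1. Qed.
Lemma der1 D : der D 1 = 0.
Proof. by rewrite -mon_nil der_mon. Qed.

Lemma derD D x y : der D (x + y) = der D x + der D y. Proof. exact: linearD. Qed.
Lemma derZ D c x : der D (c *: x) = c *: der D x. Proof. exact: linearZ. Qed.
Lemma der0 D : der D 0 = 0. Proof. exact: linear0. Qed.
Lemma derN D x : der D (- x) = - der D x. Proof. exact: linearN. Qed.
Lemma derB D x y : der D (x - y) = der D x - der D y. Proof. exact: linearB. Qed.
Lemma der_sum D I r (K : pred I) (F : I -> Q) :
  der D (\sum_(i <- r | K i) F i) = \sum_(i <- r | K i) der D (F i).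
Proof. exact: linear_sum. Qed.

Lemma derM D e x y : par e x ->
  der D (x * y) = der D x * y + sgn (spar D && e) *: (x * der D y).
Proof.
move: x; apply: span_ind => [|c u x /eqP<- IH].
  by rewrite !(mul0r, der0, scaler0, addr0).
rewrite !mulrDl derD IH derD mulrDl scalerDr [RHS]addrACA; congr (_ + _) => {x IH}.
rewrite derZ -!scalerAl derZ scale_swap -scalerDr; congr (_ *: _).
elim/(@Q_span R n N): y => [|d v y IH]; first by rewrite !(mulr0, der0, scaler0, addr0).
rewrite mulrDr !derD IH !mulrDr scalerDr [RHS]addrACA; congr (_ + _).
by rewrite -scalerAr !derZ -monM !der_mon derw_cat scalerDr -!scalerAr scale_swap.
Qed.

Lemma derM_even D x y : par false x -> der D (x * y) = der D x * y + x * der D y.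
Proof. by move/derM->; rewrite andbF scale1r. Qed.

Lemma der_gxM D g y :
  der D (gx g * y) = sfun D g * y + sgn (spar D && gen_odd g) *: (gx g * der D y).
Proof. by rewrite (derM _ _ (par_gx g)) der_gx. Qed.

(** Here [T w u] reads: the word [u] may occur in the image of [w]. By the Leibniz rule it is enough
    to know this on generators and to have [T] stable under adding letters. Parity, antighost number
    and weights are all tracked this way. *)
Lemma der_span_mon D (T : W -> pred W) :
  (forall g, span (T [:: g]) (sfun D g)) ->
  (forall g u w, T [:: g] u -> T (g :: w) (u ++ w)) ->
  (forall g u w, T w u -> T (g :: w) (g :: u)) ->
  forall w, span (T w) (der D (mon w)).
Proof.
move=> Hg Hl Hr; elim=> [|g w IH]; first by rewrite der_mon; apply: span0.
rewrite mon_cons der_gxM; apply: spanD.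
  apply: (@spanM (T [:: g]) (pred1 w)) => [u v Tu /eqP->||]; [exact: Hl|exact: Hg|].
  by apply: span_mon; rewrite /= eqxx.
apply: spanZ; apply: (@spanM (pred1 [:: g]) (T w)) => [u v /eqP-> Tv||//]; first exact: Hr.
by apply: span_mon; rewrite /= eqxx.
Qed.

Lemma der_par D e x : par e x -> par (spar D (+) e) (der D x).
Proof.
apply: span_linear => w /eqP<-.
apply: (@der_span_mon D (fun w u => wodd u == spar D (+) wodd w)) => [g|g u v|g u v].
- by apply: sub_span (sderP D g) => u /=; rewrite wodd_cons addbF.
- by rewrite wodd_cat !wodd_cons addbF => /eqP->; rewrite addbA.
- by rewrite !wodd_cons => /eqP->; rewrite addbCA.
Qed.

Definition brk D1 D2 x := der D1 (der D2 x) - sgn (spar D1 && spar D2) *: der D2 (der D1 x).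

Lemma brk_is_linear D1 D2 : linear (brk D1 D2).
Proof.
move=> c x y; rewrite /brk !(derD, derZ) scalerBr !scalerDr opprD addrACA.
by congr (_ - _ + _); rewrite scale_swap.
Qed.
HB.instance Definition _ D1 D2 :=
  GRing.isLinear.Build R Q Q _ (brk D1 D2) (brk_is_linear D1 D2).

(** The graded commutator is again a derivation, of the summed parity, and is therefore determined
    by its values on generators. *)
Lemma brk_gxM D1 D2 g y : brk D1 D2 (gx g * y) = brk D1 D2 (gx g) * y
  + sgn ((spar D1 (+) spar D2) && gen_odd g) *: (gx g * brk D1 D2 y).
Proof.
rewrite /brk !der_gxM !derD !derZ !der_gxM !der_gx.
rewrite !(derM _ _ (sderP _ g)).
rewrite mulrBl mulrBr -scalerAl -scalerAr.
set A := der D1 _ * y; set A' := der D2 _ * y; set B := _ * der D1 y.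
set B' := _ * der D2 y; set E := gx g * _; set E' := gx g * _.
rewrite scalerBr !scalerDr !scalerA !opprD -!sgnD.
have -> : (spar D1 && spar D2) (+) (spar D2 && (spar D1 (+) gen_odd g)) = spar D2 && gen_odd g.
  by case: (spar D1); case: (spar D2); case: (gen_odd g).
have -> : (spar D1 && spar D2) (+) (spar D1 && gen_odd g) = spar D1 && (spar D2 (+) gen_odd g).
  by case: (spar D1); case: (spar D2); case: (gen_odd g).
have -> : (spar D2 && gen_odd g) (+) (spar D1 && gen_odd g) = (spar D1 (+) spar D2) && gen_odd g.
  by case: (spar D1); case: (spar D2); case: (gen_odd g).
have -> : (spar D1 && (spar D2 (+) gen_odd g)) (+) (spar D2 && gen_odd g) =
          ((spar D1 (+) spar D2) && gen_odd g) (+) (spar D1 && spar D2).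
  by case: (spar D1); case: (spar D2); case: (gen_odd g).
exact: bracket_cancel.
Qed.

Lemma der_comm D1 D2 x : spar D1 = false ->
  (forall g, der D1 (sfun D2 g) = der D2 (sfun D1 g)) ->
  der D1 (der D2 x) = der D2 (der D1 x).
Proof.
move=> e1 H; apply/eqP; rewrite -subr_eq0; apply/eqP.
rewrite -[X in _ - X]scale1r -[1]/(sgn (false && spar D2)) -e1 -/(brk D1 D2 x).
elim/(@Q_span R n N): x => [|c w x IH]; first by rewrite linear0.
rewrite linearP /= IH addr0.
suff -> : brk D1 D2 (mon w) = 0 by rewrite scaler0.
elim: w => [|g w IHw]; first by rewrite mon_nil /brk !der1 !der0 scaler0 subrr.
by rewrite mon_cons brk_gxM IHw mulr0 scaler0 addr0 /brk !der_gx H e1 scale1r subrr mul0r.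
Qed.

(** For odd [D] the graded commutator of [D] with itself is twice its square, and 2 is
    invertible. *)
Lemma der_sq0 D x : spar D = true -> (forall g, der D (sfun D g) = 0) ->
  der D (der D x) = 0.
Proof.
move=> e1 H; suff : brk D D x = 0.
  rewrite /brk e1 /sgn /= expr1 scaleN1r opprK => /eqP.
  by rewrite -mulr2n -scaler_nat scaler_eq0 pnatr_eq0 /= => /eqP.
elim/(@Q_span R n N): x => [|c w x IH]; first by rewrite linear0.
rewrite linearP /= IH addr0.
suff -> : brk D D (mon w) = 0 by rewrite scaler0.
elim: w => [|g w IHw]; first by rewrite mon_nil /brk !der1 !der0 scaler0 subrr.
by rewrite mon_cons brk_gxM IHw mulr0 scaler0 addr0 /brk !der_gx H scaler0 subrr mul0r.
Qed.

(** * Additive degrees of words and supports of coefficients *)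

Definition wt (d : G -> nat) w := sumn (map d w).
Lemma wt_cat d u v : wt d (u ++ v) = (wt d u + wt d v)%N.
Proof. by rewrite /wt map_cat sumn_cat. Qed.
Lemma wt_cons d g w : wt d (g :: w) = (d g + wt d w)%N. Proof. by []. Qed.
Lemma wt1 d g : wt d [:: g] = d g. Proof. by rewrite /wt /= addn0. Qed.

Lemma wt_perm d u v : perm_eq u v -> wt d u = wt d v.
Proof. by move=> H; rewrite /wt !sumnE; apply: perm_big; apply: perm_map. Qed.

(** With [support_span], the bridge between conditions on coefficients, as in [has_agh], and spans.
    The converse needs [S] invariant under reordering because coefficients are read off sorted
    words. *)
Lemma cl_support p (S : pred W) : (forall m, ~~ S m -> pcoef p m = 0) -> span S (cl p).
Proof.
move=> H; rewrite clE.
rewrite (linext_normal (@mon_gcomm R n N) (undup_uniq [seq sortw t.2 | t <- p])); last first.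
  by move=> m; rewrite mem_undup.
apply: span_sum => m _; case: (boolP (S m)) => [Sm|/H ->]; last by rewrite scale0r; apply: span0.
by apply: spanZ; apply: span_mon.
Qed.

Lemma support_span p (S : pred W) : (forall u v, perm_eq u v -> S u = S v) ->
  span S (cl p) -> forall m, ~~ S m -> pcoef p m = 0.
Proof.
move=> HS [q Hq /clP E] m Sm; rewrite E /pcoef big_seq big1 // => x xq.
case: ifP => // /andP[_ /eqP Em]; case/negP: Sm.
by rewrite -Em (HS _ _ (sortw_perm _)); apply: (allP Hq).
Qed.
End Derivations.

(** * Deciding equalities in abelian groups *)

Inductive zexp := ZV of nat | ZA of zexp & zexp | ZO of zexp | Z0.
Fixpoint zev (V : zmodType) (env : seq V) e : V :=
  match e with
  | ZV i => nth 0 env i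
  | ZA e f => zev env e + zev env f
  | ZO e => - zev env e
  | Z0 => 0
  end.
Fixpoint zco e (i : nat) : int :=
  match e with
  | ZV j => (i == j)%:Z
  | ZA e f => zco e i + zco f i
  | ZO e => - zco e i
  | Z0 => 0
  end.

Lemma zevE (V : zmodType) (env : seq V) e :
  zev env e = \sum_(i < size env) nth 0 env i *~ zco e i.
Proof.
elim: e => [j|e IHe f IHf|e IHe|] /=.
- case: (ltnP j (size env)) => [lt_j|le_j].
    rewrite (bigD1 (Ordinal lt_j)) //= eqxx mulr1z big1 ?addr0 // => i ne_ij.
    by rewrite (_ : (i == j :> nat) = false) ?mulr0z //; apply/negbTE.
  (* A variable beyond the environment evaluates to the default 0. *)
  rewrite nth_default // big1 // => i _.
  by rewrite (_ : (i == j :> nat) = false) ?mulr0z // ltn_eqF // (leq_trans (ltn_ord i)).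
- by rewrite IHe IHf -big_split; apply: eq_bigr => i _; rewrite mulrzDr.
- by rewrite IHe -sumrN; apply: eq_bigr => i _; rewrite mulrNz.
- by rewrite big1 // => i _; rewrite mulr0z.
Qed.

(** Both sides are integer combinations of the atoms in [env], and comparing their coefficients is a
    closed boolean computation. *)
Lemma zmodP (V : zmodType) (env : seq V) e f :
  all (fun i => zco e i == zco f i) (iota 0 (size env)) -> zev env e = zev env f.
Proof.
move=> /allP H; rewrite !zevE; apply: eq_bigr => i _.
by rewrite (eqP (H i _)) // mem_iota /= add0n.
Qed.

(* Equal products may carry syntactically different (convertible) structures. *)
Ltac zeq x y :=
  first [constr_eq x y |
    lazymatch x with
    | (?a * ?b)%R => lazymatch y with (?c * ?d)%R => zeq a c; zeq b d end
    | (?a *: ?b)%R => lazymatch y with (?c *: ?d)%R => zeq a c; zeq b d end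
    end].
Ltac zmem x l :=
  lazymatch l with
  | nil => constr:(false)
  | cons ?y ?l' => match tt with
      | _ => let _ := match tt with _ => zeq x y end in constr:(true)
      | _ => zmem x l'
      end
  end.
Ltac zenv V e l :=
  lazymatch e with
  | (?a + ?b)%R => let l := zenv V a l in zenv V b l
  | (- ?a)%R => zenv V a l
  | (0)%R => l
  | _ => let b := zmem e l in
         lazymatch b with true => l | false => constr:(@cons V e l) end
  end.
Ltac zidx x l :=
  lazymatch l with
  | cons ?y ?l' => match tt with
      | _ => let _ := match tt with _ => zeq x y end in constr:(0%N)
      | _ => let i := zidx x l' in constr:(S i)
      end
  end.
Ltac zquote e l :=
  lazymatch e with
  | (?a + ?b)%R => let a' := zquote a l in let b' := zquote b l in constr:(ZA a' b')
  | (- ?a)%R => let a' := zquote a l in constr:(ZO a')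
  | (0)%R => constr:(Z0)
  | _ => let i := zidx e l in constr:(ZV i)
  end.
Ltac zmod :=
  lazymatch goal with
  | |- @eq ?V ?a ?b =>
    let l := zenv V a (@nil V) in let l := zenv V b l in
    let a' := zquote a l in let b' := zquote b l in
    apply: (@zmodP _ l a' b'); vm_compute; reflexivity
  end.

(** * Total derivatives *)

Section TotalDerivative.
Variables (R : realType) (n N : nat).
Notation G := (gen n N).
Notation W := (word n N).
Notation Q := (Q R n N).
Notation cl := (@cl R n N).
Notation mindex := {ffun 'I_n -> nat}.
Implicit Types (g h : G) (u v w : W) (x y z : Q) (p q : Pelt R n N) (J K : mindex) (mu nu : 'I_n).

Lemma cl_pneg p : cl (pneg p) = - cl p. Proof. by rewrite clZ scaleN1r. Qed.

Lemma cl_flatten (I : Type) (s : seq I) (f : I -> Pelt R n N) :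
  cl (flatten [seq f i | i <- s]) = \sum_(i <- s) cl (f i).
Proof. by elim: s => [|i s IH]; rewrite ?big_nil // big_cons -IH /= clD. Qed.

Lemma cl_psum (I : finType) (f : I -> Pelt R n N) : cl (psum f) = \sum_i cl (f i).
Proof. by rewrite /psum cl_flatten big_enum. Qed.

Lemma cl_lmul g p : cl [seq (t.1, g :: t.2) | t <- p] = gx g * cl p.
Proof.
rewrite !clE /linext big_map mulr_sumr; apply: eq_bigr => t _ /=.
by rewrite mon_cons scalerAr.
Qed.

Lemma cl_rmul w p : cl [seq (t.1, t.2 ++ w) | t <- p] = cl p * mon w.
Proof.
rewrite !clE /linext big_map mulr_suml; apply: eq_bigr => t _ /=.
by rewrite monM scalerAl.
Qed.

Definition tfun mu g : Q := if tder_gen mu g is Some g' then gx g' else 0.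
Lemma tfun_par mu g : par (false (+) gen_odd g) (tfun mu g).
Proof. by case: g => [b J|m] /=; [apply: (par_gx _ (Gf b (incr J mu))) | apply: span0]. Qed.
Definition Dt mu := Sder (tfun_par mu).
Notation pd mu := (der (Dt mu)).

Lemma cl_tder mu p : cl (tder mu p) = pd mu (cl p).
Proof.
rewrite /tder cl_flatten /der qlift_cl /linext; apply: eq_bigr => t _.
rewrite clZ; congr (_ *: _); elim: t.2 => [|g w IH] //=.
rewrite clD cl_lmul IH /= scale1r; congr (_ + _).
by case: g => [b J|m] /=; rewrite ?mul0r // -mon_cons.
Qed.

Lemma pd_gx mu b J : pd mu (gx (Gf b J)) = gx (Gf b (incr J mu)).
Proof. exact: der_gx. Qed.

Lemma incrC J mu nu : incr (incr J mu) nu = incr (incr J nu) mu.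
Proof. by apply/ffunP => i; rewrite !ffunE addnAC. Qed.

Lemma pdC mu nu x : pd mu (pd nu x) = pd nu (pd mu x).
Proof.
apply: der_comm => // -[b J|m]; rewrite /= /tfun /= ?der0 //.
by rewrite !der_gx /= /tfun /= incrC.
Qed.

Definition pdI J x := foldr (fun mu y => iter (J mu) (pd mu) y) x (enum 'I_n).

Lemma cl_tderI J p : cl (tderI J p) = pdI J (cl p).
Proof.
rewrite /tderI /pdI; elim: (enum 'I_n) => [|mu s IH] //=.
by rewrite -IH; elim: (J mu) => [|i IHi] //=; rewrite cl_tder IHi.
Qed.

Lemma pdI0 x : pdI (I0 n) x = x.
Proof. by rewrite /pdI; elim: (enum 'I_n) => [|mu s IH] //=; rewrite ffunE. Qed.

Lemma iter_pdC mu nu i x : iter i (pd nu) (pd mu x) = pd mu (iter i (pd nu) x).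
Proof. by elim: i => [|i IH] //=; rewrite IH pdC. Qed.

Lemma pdI_incr J mu x : pdI (incr J mu) x = pd mu (pdI J x).
Proof.
rewrite /pdI; set f := (fun _ => _); set f' := (fun _ => _).
(* Generalised to sublists of the directions: the extra derivative appears where the fold meets
   [mu], then commutes outwards past the other directions. *)
suff H s : uniq s -> foldr f x s = if mu \in s then pd mu (foldr f' x s) else foldr f' x s.
  by rewrite H ?enum_uniq // mem_enum.
elim: s => [|nu s IH] //= /andP[nu_s Us]; rewrite (IH Us) inE /f /f' ffunE eq_sym.
case: (eqVneq mu nu) => [->|_] /=; first by rewrite (negPf nu_s) addn1.
by rewrite addn0; case: (mu \in s); rewrite // iter_pdC.
Qed.

Lemma mindex_ind (S : mindex -> Prop) :
  S (I0 n) -> (forall J mu, S J -> S (incr J mu)) -> forall J, S J.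
Proof.
move=> S0 Si J; have [m] := ubnP (\sum_mu J mu).
elim: m J => // m IH J; case: (pickP (fun mu => J mu != 0)%N) => [mu Jmu|J0] lt_m.
  pose J' := [ffun nu => (J nu - (nu == mu))%N].
  have -> : J = incr J' mu.
    by apply/ffunP => nu; rewrite !ffunE subnK //; case: eqP => // ->; rewrite lt0n.
  apply/Si/IH; rewrite -ltnS; apply: leq_trans lt_m; rewrite ltnS.
  rewrite (bigD1 mu) // [X in (_ < X)%N](bigD1 mu) //= ffunE eqxx.
  rewrite (eq_bigr J) => [|nu /negPf ne]; last by rewrite ffunE ne subn0.
  by move: Jmu; case: (J mu) => // j _; rewrite subn1.
suff -> : J = I0 n by [].
by apply/ffunP => nu; rewrite ffunE; apply/eqP; move: (J0 nu) => /negbFE.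
Qed.

Lemma pdI_gx b J : pdI J (gx (Gf b (I0 n))) = gx (Gf b J).
Proof. by elim/mindex_ind: J => [|J mu IH]; rewrite ?pdI0 // pdI_incr IH pd_gx. Qed.

Lemma pdI_linear J : linear (pdI J).
Proof.
move=> c x y; elim/mindex_ind: J => [|J mu IH]; first by rewrite !pdI0.
by rewrite !pdI_incr IH derD derZ.
Qed.
HB.instance Definition _ J := GRing.isLinear.Build R Q Q _ (pdI J) (pdI_linear J).

Lemma pdID J x y : pdI J (x + y) = pdI J x + pdI J y. Proof. exact: linearD. Qed.
Lemma pdIZ J c x : pdI J (c *: x) = c *: pdI J x. Proof. exact: linearZ. Qed.
Lemma pdIN J x : pdI J (- x) = - pdI J x. Proof. exact: linearN. Qed.
Lemma pdIB J x y : pdI J (x - y) = pdI J x - pdI J y. Proof. exact: linearB. Qed.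
Lemma pdI_sum J I r (S : pred I) (F : I -> Q) :
  pdI J (\sum_(i <- r | S i) F i) = \sum_(i <- r | S i) pdI J (F i).
Proof. exact: linear_sum. Qed.

Lemma pdI_pd J mu x : pdI J (pd mu x) = pd mu (pdI J x).
Proof. by elim/mindex_ind: J => [|J nu IH]; rewrite ?pdI0 // !pdI_incr IH pdC. Qed.

Definition agh := @gen_agh n N.
Definition nodd g : nat := gen_odd g.

(** Bidegree by number of odd letters and antighost number. Counting the odd letters, rather than
    taking their parity, makes both degrees additive. *)
Definition hom2 i j x := span (fun w => (wt nodd w == i) && (wt agh w == j)) x.

Lemma wodd_wt w : wodd w = odd (wt nodd w).
Proof. by elim: w => [|g w IH] //; rewrite wodd_cons wt_cons oddD IH oddb. Qed.

Lemma hom2_par i j x : hom2 i j x -> par (odd i) x.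
Proof. by apply: sub_span => w /andP[/eqP<- _]; rewrite wodd_wt. Qed.

Lemma hom2M i j i' j' x y : hom2 i j x -> hom2 i' j' y -> hom2 (i + i') (j + j') (x * y).
Proof.
apply: spanM => u v /andP[/eqP<- /eqP<-] /andP[/eqP<- /eqP<-].
by rewrite !wt_cat !eqxx.
Qed.

Lemma hom2_pd i j mu x : hom2 i j x -> hom2 i j (pd mu x).
Proof.
apply: span_linear => w /andP[/eqP<- /eqP<-].
apply: (@der_span_mon _ _ _ (Dt mu)
  (fun w u => (wt nodd u == wt nodd w) && (wt agh u == wt agh w))) => [g|g u v|g u v].
- case: g => [b J|m] /=; last exact: span0.
  by apply: span_mon; rewrite !eqxx.
- by rewrite !wt_cat !wt1 => /andP[/eqP-> /eqP->]; rewrite !wt_cons !eqxx.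
- by rewrite !wt_cons => /andP[/eqP-> /eqP->]; rewrite !eqxx.
Qed.

Lemma hom2_gx g : hom2 (nodd g) (agh g) (gx g).
Proof. by apply: span_mon; rewrite !wt1 !eqxx. Qed.

End TotalDerivative.

(** * The Koszul-Tate differential squares to zero *)

Local Notation pd mu := (der (Dt _ _ mu)).

Section KoszulTate.
Variables (R : realType) (n N : nat).
Variables (C : 'I_N -> 'I_N -> 'I_N -> R) (k : 'M[R]_N) (lam : R).
Notation G := (gen n N).
Notation W := (word n N).
Notation Q := (Q R n N).
Notation cl := (@cl R n N).
Implicit Types (g h : G) (u v w : W) (x y z : Q) (J K : {ffun 'I_n -> nat}) (mu nu rho : 'I_n)
  (a b c d : 'I_N).

(** * Field strengths and the differential as classes in the quotient *)

Notation fam := ('I_N -> Q).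
Definition gf (t : base n N) : Q := gx (Gf t (I0 n)).
Definition asym (mk : pairlt n -> base n N) mu nu : Q :=
  (if (insub (mu, nu) : option (pairlt n)) is Some q then gf (mk q) else 0)
  - (if (insub (nu, mu) : option (pairlt n)) is Some q then gf (mk q) else 0).

Lemma cl_asym mk mu nu : cl (antisym_comp R mk mu nu) = asym mk mu nu.
Proof. by rewrite clD cl_pneg; congr (_ - _); case: insub. Qed.

Lemma asymC mk mu nu : asym mk mu nu = - asym mk nu mu.
Proof. by rewrite /asym opprB. Qed.

Definition br (X Y : fam) a : Q := \sum_b \sum_c C a b c *: (X b * Y c).
Definition gA mu : fam := fun a => gf (bA a mu).
Definition gF mu nu : fam := fun a =>
  pd mu (gA nu a) - pd nu (gA mu a) - br (gA mu) (gA nu) a.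
Definition low (X : fam) : fam := fun a => \sum_b k a b *: X b.
Definition rai (X : fam) : fam := fun b => \sum_d invmx k b d *: X d.
Definition cov nu (X : fam) : fam := fun b => pd nu (X b) - br (gA nu) X b.

Definition gH0 mu nu rho : Q :=
  pd mu (asym bB nu rho) + pd nu (asym bB rho mu) + pd rho (asym bB mu nu).
(** [gHA] and [gHF] are the cubic part and the [A F] part of the Chern-Simons form of [A]. *)
Definition gHA mu nu rho : Q :=
  \sum_a \sum_b \sum_c Clo C k a b c *: (gA mu a * (gA nu b * gA rho c)).
Definition gHF mu nu rho : Q :=
  \sum_a (gA mu a * low (gF nu rho) a + gA nu a * low (gF rho mu) a
          + gA rho a * low (gF mu nu) a).
Definition gH mu nu rho : Q := gH0 mu nu rho + (-2 * lam) *: gHA mu nu rho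
  + (-2 * lam) *: gHF mu nu rho.
Notation eta := (@mink R n).
Definition gHup mu nu rho : Q := (eta mu * eta nu * eta rho) *: gH mu nu rho.

Lemma cl_fF a mu nu : cl (fF C a mu nu) = gF mu nu a.
Proof.
rewrite /fF clD cl_tder clD !cl_pneg cl_tder addrA; congr (_ - _).
rewrite cl_psum /br pair_bigA; apply: eq_bigr => p _.
by rewrite clZ clM.
Qed.

Lemma cl_fFlo a mu nu : cl (fFlo C k a mu nu) = low (gF mu nu) a.
Proof. by rewrite cl_psum; apply: eq_bigr => b _; rewrite clZ cl_fF. Qed.

Lemma cl_fH mu nu rho : cl (fH C k lam mu nu rho) = gH mu nu rho.
Proof.
rewrite /fH clD cl_tder clD cl_tder clD cl_tder clD !clZ !cl_asym /gH /gH0 !addrA;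
  congr (_ + _ + _).
  congr (_ *: _); rewrite cl_psum /gHA pair_bigA pair_bigA.
  by apply: eq_bigr => p _; rewrite clZ !clM.
congr (_ *: _); rewrite cl_psum; apply: eq_bigr => a _.
by rewrite clD clM clD !clM !cl_fFlo addrA.
Qed.

Lemma cl_fHup mu nu rho : cl (fHup C k lam mu nu rho) = gHup mu nu rho.
Proof. by rewrite clZ cl_fH. Qed.

Lemma cl_covD nu X a : cl (covD C k nu X a) = low (cov nu (rai (fun d => cl (X d)))) a.
Proof.
have Hr b : cl (raise k X b) = rai (fun d => cl (X d)) b.
  by rewrite cl_psum; apply: eq_bigr => d _; rewrite clZ.
rewrite cl_psum; apply: eq_bigr => b _; rewrite clZ clD cl_pneg cl_tder Hr.
congr (_ *: (_ - _)); rewrite cl_psum /br pair_bigA; apply: eq_bigr => p _.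
by rewrite clZ clM Hr.
Qed.

(** The equation of motion of [A] with its internal index raised: the differential of [bAs a mu] is
    [low (gY mu) a]. With raised indices the covariant derivative involves no internal metric. *)
Definition gY mu : fam := fun b => \sum_nu cov nu (fun c => (eta nu * eta mu) *: gF nu mu c) b
  + (2 * lam) *: \sum_nu \sum_rho gHup mu nu rho * gF nu rho b.

Definition gdelta (t : base n N) : Q :=
  match t with
  | bAs a mu => low (gY mu) a
  | bCs a => (2 * lam) *: (\sum_mu \sum_nu asym bBs mu nu * low (gF mu nu) a)
             - \sum_mu low (cov mu (rai (fun c => gf (bAs c mu)))) a
  | bBs q => \sum_rho pd rho (gHup rho (val q).1 (val q).2)
  | betas mu => - \sum_nu pd nu (asym bBs nu mu)
  | brhos => - \sum_mu pd mu (gf (betas mu))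
  | _ => 0
  end.

Lemma lowD X Y a : low (fun b => X b + Y b) a = low X a + low Y a.
Proof. by rewrite /low -big_split; apply: eq_bigr => b _; rewrite scalerDr. Qed.
Lemma lowZ (r : R) X a : low (fun b => r *: X b) a = r *: low X a.
Proof. by rewrite /low scaler_sumr; apply: eq_bigr => b _; rewrite scale_swap. Qed.
Lemma low_sum (I : finType) (X : I -> fam) a :
  low (fun b => \sum_i X i b) a = \sum_i low (X i) a.
Proof. by rewrite /low exchange_big; apply: eq_bigr => b _; rewrite scaler_sumr. Qed.
Lemma lowMl x X a : low (fun b => x * X b) a = x * low X a.
Proof. by rewrite /low mulr_sumr; apply: eq_bigr => b _; rewrite scalerAr. Qed.
Lemma eq_low X Y a : X =1 Y -> low X a = low Y a.
Proof. by move=> E; apply: eq_bigr => b _; rewrite E. Qed.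
Lemma eq_br X Y X' Y' a : X =1 X' -> Y =1 Y' -> br X Y a = br X' Y' a.
Proof. by move=> E E'; apply: eq_bigr => b _; apply: eq_bigr => c _; rewrite E E'. Qed.
Lemma eq_cov mu X Y b : X =1 Y -> cov mu X b = cov mu Y b.
Proof. by move=> E; rewrite /cov E (eq_br (X' := gA mu) (Y' := Y)). Qed.

Hypothesis kU : k \in unitmx.
Lemma raiK X a : rai (low X) a = X a.
Proof.
rewrite /rai /low; under eq_bigr => d _ do rewrite scaler_sumr.
rewrite exchange_big /= (bigD1 a) //= [X in _ + X]big1 ?addr0 => [|b ne_ba].
- under eq_bigr => d _ do rewrite scalerA.
  by rewrite -scaler_suml; have := mulVmx kU => /matrixP/(_ a a); rewrite !mxE eqxx => ->;
    rewrite scale1r.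
- under eq_bigr => d _ do rewrite scalerA.
  rewrite -scaler_suml; have := mulVmx kU => /matrixP/(_ a b);
    rewrite !mxE eq_sym (negPf ne_ba) => ->.
  by rewrite scale0r.
Qed.

Lemma lowK X a : low (rai X) a = X a.
Proof.
rewrite /rai /low; under eq_bigr => d _ do rewrite scaler_sumr.
rewrite exchange_big /= (bigD1 a) //= [X in _ + X]big1 ?addr0 => [|b ne_ba].
- under eq_bigr => d _ do rewrite scalerA.
  by rewrite -scaler_suml; have := mulmxV kU => /matrixP/(_ a a); rewrite !mxE eqxx => ->;
    rewrite scale1r.
- under eq_bigr => d _ do rewrite scalerA.
  rewrite -scaler_suml; have := mulmxV kU => /matrixP/(_ a b);
    rewrite !mxE eq_sym (negPf ne_ba) => ->.
  by rewrite scale0r.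
Qed.

Lemma cl_delta_base t : cl (delta_base C k lam t) = gdelta t.
Proof.
case: t => //=.
- move=> a mu; rewrite clD clZ !cl_psum /gY lowD lowZ low_sum; congr (_ + _ *: _).
    apply: eq_bigr => nu _; rewrite cl_covD; apply: eq_low => b; apply: eq_cov => c.
    rewrite -[RHS](raiK (fun c => _ *: gF nu mu c)); apply: eq_bigr => d _.
    by rewrite clZ cl_fFlo lowZ.
  rewrite low_sum.
  under [RHS]eq_bigr do rewrite low_sum.
  rewrite pair_bigA; apply: eq_bigr => p _; rewrite clM cl_fHup cl_fFlo lowMl //.
- move=> a; rewrite clD clZ cl_pneg !cl_psum; congr (_ *: _ - _).
    by rewrite pair_bigA; apply: eq_bigr => p _; rewrite clM cl_fFlo cl_asym.
  by apply: eq_bigr => mu _; rewrite cl_covD.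
- by move=> q; rewrite cl_psum; apply: eq_bigr => rho _; rewrite cl_tder cl_fHup.
- by move=> mu; rewrite cl_pneg cl_psum; congr (- _); apply: eq_bigr => nu _;
  rewrite cl_tder cl_asym.
- by rewrite cl_pneg cl_psum; congr (- _); apply: eq_bigr => nu _; rewrite cl_tder.
Qed.

(** * Degrees of the field strengths and of the differential *)

Lemma hom_gf t : hom2 (base_odd t) (base_agh t) (gf t).
Proof. exact: (@hom2_gx R n N (Gf t (I0 n))). Qed.

Lemma hom_asym mk i j mu nu : (forall q, hom2 i j (gf (mk q))) -> hom2 i j (asym mk mu nu).
Proof. by move=> H; apply: spanB; case: insub => [q|]; try exact: H; apply: span0. Qed.

Lemma hom_br X Y i j i' j' a : (forall b, hom2 i j (X b)) -> (forall b, hom2 i' j' (Y b)) ->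
  hom2 (i + i') (j + j') (br X Y a).
Proof.
move=> HX HY; apply: span_sum => b _; apply: span_sum => c _; apply: spanZ; exact: hom2M.
Qed.

Lemma hom_low X i j a : (forall b, hom2 i j (X b)) -> hom2 i j (low X a).
Proof. by move=> HX; apply: span_sum => b _; apply: spanZ; apply: HX. Qed.
Lemma hom_rai X i j a : (forall b, hom2 i j (X b)) -> hom2 i j (rai X a).
Proof. by move=> HX; apply: span_sum => b _; apply: spanZ; apply: HX. Qed.

Lemma hom_A mu a : hom2 0 0 (gA mu a). Proof. exact: (hom_gf (bA a mu)). Qed.

Lemma hom_cov X i j nu a : (forall b, hom2 i j (X b)) -> hom2 i j (cov nu X a).
Proof.
move=> HX; apply: spanB; first exact: hom2_pd.
by apply: (@hom_br _ _ 0 0) => //; apply: hom_A.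
Qed.

Lemma hom_F mu nu a : hom2 0 0 (gF mu nu a).
Proof.
apply: spanB; first by apply: spanB; apply: hom2_pd; apply: hom_A.
by apply: (@hom_br _ _ 0 0 0 0); apply: hom_A.
Qed.

Lemma hom_H mu nu rho : hom2 0 0 (gH mu nu rho).
Proof.
have HB m m' : hom2 0 0 (asym bB m m') by apply: hom_asym => q; apply: (hom_gf (bB q)).
have HM := @hom2M R n N 0 0 0 0.
apply: spanD; first apply: spanD.
- by apply: spanD; first apply: spanD; apply: hom2_pd.
- apply: spanZ; do 3!(apply: span_sum => ? _); apply: spanZ.
  by apply HM; last apply HM; apply: hom_A.
- apply: spanZ; apply: span_sum => a _.
  by apply: spanD; first apply: spanD; apply HM; try exact: hom_A;
    apply: hom_low => b; apply: hom_F.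
Qed.

Lemma hom_Hup mu nu rho : hom2 0 0 (gHup mu nu rho).
Proof. by apply: spanZ; apply: hom_H. Qed.

Lemma hom_Bs mu nu : hom2 1 1 (asym bBs mu nu).
Proof. by apply: hom_asym => q; apply: (hom_gf (bBs q)). Qed.

(** Number of odd letters in the terms of [gdelta t]: one antifield [bAs] or [bBs] for [bCs] and
    [betas]; none for [brhos], whose image is linear in the even [betas]. *)
Definition dodd (t : base n N) := match t with bCs _ | betas _ => 1 | _ => 0 end%N.

Lemma hom_gdelta t : hom2 (dodd t) (base_agh t).-1 (gdelta t).
Proof.
have HM := @hom2M R n N 0 0 0 0; have HM1 := @hom2M R n N 1 1 0 0.
case: t => /=; try by intros; exact: span0.
- move=> a mu; apply: hom_low => b; apply: spanD.
    by apply: span_sum => nu _; apply: hom_cov => c; apply: spanZ; apply: hom_F.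
  by apply: spanZ; do 2!(apply: span_sum => ? _); apply HM; [apply: hom_Hup | apply: hom_F].
- move=> a; apply: spanB.
    apply: spanZ; do 2!(apply: span_sum => ? _); apply HM1; first exact: hom_Bs.
    by apply: hom_low => b; apply: hom_F.
  apply: span_sum => mu _; apply: hom_low => b; apply: hom_cov => c; apply: hom_rai => d.
  exact: (hom_gf (bAs d mu)).
- by move=> q; apply: span_sum => rho _; apply: hom2_pd; apply: hom_Hup.
- by move=> mu; apply: spanN; apply: span_sum => nu _; apply: hom2_pd; apply: hom_Bs.
- by apply: spanN; apply: span_sum => nu _; apply: hom2_pd; apply: (hom_gf (betas nu)).
Qed.

Lemma hom2_pdI i j J x : hom2 i j x -> hom2 i j (pdI J x).
Proof.
by move=> Hx; elim/mindex_ind: J => [|J mu IH]; rewrite ?pdI0 // pdI_incr; apply: hom2_pd.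
Qed.

Lemma cl_delta_gen t J : cl (delta_gen C k lam (Gf t J)) = pdI J (gdelta t).
Proof. by rewrite cl_tderI cl_delta_base. Qed.

Lemma delta_gen_par g : par (true (+) gen_odd g) (cl (delta_gen C k lam g)).
Proof.
case: g => [t J|m]; last exact: span0.
rewrite cl_delta_gen; have /hom2_par := hom2_pdI J (hom_gdelta t).
by case: t => //= *; rewrite linear0; exact: span0.
Qed.
Definition Dd := Sder delta_gen_par.
Notation dl := (der Dd).

Lemma cl_delta p : cl (delta C k lam p) = dl (cl p).
Proof.
rewrite /delta cl_flatten /der qlift_cl /linext; apply: eq_bigr => t _.
rewrite clZ; congr (_ *: _); elim: t.2 => [|g w IH] //=.
rewrite clD cl_rmul clZ cl_lmul IH /gsign /sgn /=; congr (_ + _ *: _).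
by case: (gen_odd g).
Qed.

Lemma dl_gf t : dl (gf t) = gdelta t.
Proof. by rewrite der_gx /= cl_tderI cl_delta_base pdI0. Qed.
Lemma dl_gx t J : dl (gx (Gf t J)) = pdI J (gdelta t).
Proof. by rewrite der_gx /= cl_tderI cl_delta_base. Qed.

Lemma dl_pd mu x : dl (pd mu x) = pd mu (dl x).
Proof.
symmetry; apply: der_comm => // -[t J|m] /=; last by rewrite /tfun /= !der0.
by rewrite cl_delta_gen dl_gx pdI_incr.
Qed.

Lemma dl_pdI J x : dl (pdI J x) = pdI J (dl x).
Proof. by elim/mindex_ind: J => [|J mu IH]; rewrite ?pdI0 // !pdI_incr dl_pd IH. Qed.

(** The successor stands on the left so that no word [u] qualifies when [w] has antighost number 0;
    the image then vanishes, as [dl_field] needs. *)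
Lemma dl_agh_mon w : span (fun u => (wt (@agh n N) u).+1 == wt (@agh n N) w) (dl (mon w)).
Proof.
apply: (@der_span_mon _ _ _ Dd (fun w u => (wt (@agh n N) u).+1 == wt (@agh n N) w)) =>
  [[t J|m]|g u v|g u v].
- rewrite /= cl_delta_gen wt1; have {}H : span (fun u =>
  wt (@agh n N) u == (base_agh t).-1) (pdI J (gdelta t)).
    by apply: sub_span (hom2_pdI J (hom_gdelta t)) => u /andP[].
  by case: t H => [? ?|?|?|?||? ?|?|?|?|] /= H; try (by rewrite linear0; apply: span0);
    apply: sub_span H.
- exact: span0.
- by rewrite wt_cat wt1 wt_cons -addSn => /eqP->.
- by rewrite !wt_cons -addnS => /eqP->.
Qed.

Lemma dl_field x : hom2 0 0 x -> dl x = 0.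
Proof.
move=> Hx; have : span pred0 (dl x).
  move: Hx; apply: span_linear => w /andP[_ /eqP w0].
  by apply: sub_span (dl_agh_mon w) => u; rewrite w0.
exact: span_pred0.
Qed.

(** * Bracket identities, Bianchi and Ricci *)

Hypothesis Canti : forall a b c, C a b c = - C a c b.
Hypothesis Cjac : forall a b c d,
  \sum_e (C a b e * C e c d + C a c e * C e d b + C a d e * C e b c) = 0.
Hypothesis Clo12 : forall a b c, Clo C k a b c = - Clo C k b a c.
Hypothesis Clo23 : forall a b c, Clo C k a b c = - Clo C k a c b.

Definition evf (X : fam) := forall a, par false (X a).
Implicit Types (X Y Z : fam).

Lemma evf_A mu : evf (gA mu). Proof. by move=> a; apply: (hom2_par (hom_A _ _)). Qed.
Lemma evf_F mu nu : evf (gF mu nu). Proof. by move=> a; apply: (hom2_par (hom_F _ _ _)). Qed.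
Lemma evf_pd mu X : evf X -> evf (fun a => pd mu (X a)).
Proof. by move=> HX a; apply: (@der_par _ _ _ (Dt R N mu) false). Qed.
Lemma evf_br X Y : evf X -> evf Y -> evf (br X Y).
Proof.
by move=> HX HY a; do 2!(apply: span_sum => ? _); apply: spanZ; apply: (@parM _ _ _ false false).
Qed.

Lemma brC X Y a : evf X -> evf Y -> br X Y a = - br Y X a.
Proof.
move=> HX HY; rewrite /br exchange_big -sumrN; apply: eq_bigr => c _.
rewrite -sumrN; apply: eq_bigr => b _.
by rewrite Canti scaleNr (even_comm (HX b) (HY c)).
Qed.

Lemma brDr X Y Z a : br X (fun b => Y b + Z b) a = br X Y a + br X Z a.
Proof.
rewrite /br -big_split; apply: eq_bigr => b _; rewrite -big_split; apply: eq_bigr => c _.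
by rewrite mulrDr scalerDr.
Qed.
Lemma brNr X Y a : br X (fun b => - Y b) a = - br X Y a.
Proof.
rewrite /br -sumrN; apply: eq_bigr => b _; rewrite -sumrN; apply: eq_bigr => c _.
by rewrite mulrN scalerN.
Qed.
Lemma brBr X Y Z a : br X (fun b => Y b - Z b) a = br X Y a - br X Z a.
Proof. by rewrite brDr brNr. Qed.
Lemma brDl X Y Z a : br (fun b => X b + Y b) Z a = br X Z a + br Y Z a.
Proof.
rewrite /br -big_split; apply: eq_bigr => b _; rewrite -big_split; apply: eq_bigr => c _.
by rewrite mulrDl scalerDr.
Qed.
Lemma brNl X Y a : br (fun b => - X b) Y a = - br X Y a.
Proof.
rewrite /br -sumrN; apply: eq_bigr => b _; rewrite -sumrN; apply: eq_bigr => c _.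
by rewrite mulNr scalerN.
Qed.
Lemma brBl X Y Z a : br (fun b => X b - Y b) Z a = br X Z a - br Y Z a.
Proof. by rewrite brDl brNl. Qed.
Lemma brZr (r : R) X Y a : br X (fun b => r *: Y b) a = r *: br X Y a.
Proof.
rewrite /br scaler_sumr; apply: eq_bigr => b _; rewrite scaler_sumr; apply: eq_bigr => c _.
by rewrite -scalerAr scale_swap.
Qed.
Lemma br_sumr (I : finType) X (Y : I -> fam) a :
  br X (fun b => \sum_i Y i b) a = \sum_i br X (Y i) a.
Proof.
rewrite /br [RHS]exchange_big; apply: eq_bigr => b _; rewrite [RHS]exchange_big;
  apply: eq_bigr => c _.
by rewrite mulr_sumr scaler_sumr.
Qed.
Lemma br_mulr x X Y a : par false x -> evf X -> br X (fun b => x * Y b) a = x * br X Y a.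
Proof.
move=> Hx HX; rewrite /br mulr_sumr; apply: eq_bigr => b _; rewrite mulr_sumr;
  apply: eq_bigr => c _.
by rewrite mulrA -(even_comm Hx (HX b)) -mulrA scalerAr.
Qed.

Lemma pd_br mu X Y a : evf X ->
  pd mu (br X Y a) = br (fun b => pd mu (X b)) Y a + br X (fun b => pd mu (Y b)) a.
Proof.
move=> HX; rewrite /br der_sum -big_split; apply: eq_bigr => b _.
rewrite der_sum -big_split; apply: eq_bigr => c _.
by rewrite derZ derM_even // scalerDr.
Qed.

Lemma br_br X Y Z a : br X (br Y Z) a =
  \sum_b \sum_c \sum_d (\sum_e C a b e * C e c d) *: (X b * (Y c * Z d)).
Proof.
apply: eq_bigr => b _.
under eq_bigr => e _.
  rewrite mulr_sumr scaler_sumr; under eq_bigr => c _ do rewrite mulr_sumr scaler_sumr.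
  over.
rewrite exchange_big; apply: eq_bigr => c _; rewrite exchange_big; apply: eq_bigr => d _.
rewrite scaler_suml; apply: eq_bigr => e _.
by rewrite -scalerAr scalerA.
Qed.

(** The three double brackets are relabelled, and their even factors reordered, to the common
    monomial [X b * (Y c * Z d)], whose total coefficient is the Jacobi sum of [C]. *)
Lemma jacobi X Y Z a : evf X -> evf Y -> evf Z ->
  br X (br Y Z) a + br Y (br Z X) a + br Z (br X Y) a = 0.
Proof.
move=> HX HY HZ; rewrite !br_br.
have -> : \sum_b \sum_c \sum_d (\sum_e C a b e * C e c d) *: (Y b * (Z c * X d)) =
  \sum_b \sum_c \sum_d (\sum_e C a c e * C e d b) *: (X b * (Y c * Z d)).
  rewrite [RHS]exchange_big; apply: eq_bigr => b _ /=; rewrite [RHS]exchange_big.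
  apply: eq_bigr => c _; apply: eq_bigr => d _; congr (_ *: _).
  by rewrite mulrA; symmetry; apply: even_comm (HX d) (parM (HY b) (HZ c)).
have -> : \sum_b \sum_c \sum_d (\sum_e C a b e * C e c d) *: (Z b * (X c * Y d)) =
  \sum_b \sum_c \sum_d (\sum_e C a d e * C e b c) *: (X b * (Y c * Z d)).
  rewrite exchange_big; apply: eq_bigr => b _ /=; rewrite exchange_big.
  apply: eq_bigr => c _; apply: eq_bigr => d _; congr (_ *: _).
  by rewrite [RHS]mulrA; apply: even_comm (HZ d) (parM (HX b) (HY c)).
rewrite -!big_split big1 // => b _ /=; rewrite -!big_split big1 // => c _ /=.
rewrite -!big_split big1 // => d _ /=.
by rewrite -!scalerDl -!big_split Cjac scale0r.
Qed.

Lemma gF_anti mu nu a : gF mu nu a = - gF nu mu a.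
Proof. by rewrite /gF (brC _ (evf_A mu) (evf_A nu)); zmod. Qed.

Lemma pd_gF mu nu rho a : pd mu (gF nu rho a) = pd mu (pd nu (gA rho a)) - pd mu (pd rho (gA nu a))
  - (br (fun b => pd mu (gA nu b)) (gA rho) a + br (gA nu) (fun b => pd mu (gA rho b)) a).
Proof. by rewrite /gF !derB pd_br //; apply: evf_A. Qed.

Lemma br_gF X nu rho a : br X (gF nu rho) a = br X (fun b => pd nu (gA rho b)) a
  - br X (fun b => pd rho (gA nu b)) a - br X (br (gA nu) (gA rho)) a.
Proof. by rewrite /gF !brBr. Qed.

(** Second derivatives of [A] cancel because derivatives commute, the terms bilinear in [A] and its
    derivative by antisymmetry of the bracket, the cubic ones by Jacobi. *)
Lemma bianchi mu nu rho b :
  cov mu (gF nu rho) b + cov nu (gF rho mu) b + cov rho (gF mu nu) b = 0.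
Proof.
rewrite /cov !pd_gF !br_gF.
have HA := evf_A; have HD m m' := evf_pd m (HA m').
rewrite !(brC _ (HD _ _) (HA _)).
have J := jacobi b (HA mu) (HA nu) (HA rho).
rewrite (pdC nu mu) (pdC rho mu) (pdC rho nu).
(* Zero is rewritten as the Jacobi sum, which leaves an identity between formal atoms. *)
rewrite -[RHS]J; zmod.
Qed.

(** Jacobi turns the commutator of double brackets into the bracket with [[A, A]]. The minus sign
    reflects the convention [D X = d X - [A, X]]. *)
Lemma ricci mu nu X b : evf X ->
  cov mu (cov nu X) b - cov nu (cov mu X) b = - br (gF mu nu) X b.
Proof.
move=> HX; have HA := evf_A; have HD m m' := evf_pd m (HA m').
rewrite /cov !derB !pd_br // !brBr /gF !brBl (pdC nu mu).
have J := jacobi b (HA mu) (HA nu) HX.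
rewrite (brC _ HX (evf_br (HA mu) (HA nu))) in J.
have E : br (gA nu) (br X (gA mu)) b = - br (gA nu) (br (gA mu) X) b.
  by rewrite -brNr; apply: eq_br => // c; apply: brC.
rewrite E in J.
transitivity (- br (fun b => pd mu (gA nu b)) X b + br (fun b => pd nu (gA mu b)) X b
   + (br (gA mu) (br (gA nu) X) b - br (gA nu) (br (gA mu) X) b)); first by zmod.
move/eqP: J; rewrite subr_eq0 => /eqP ->; zmod.
Qed.

Lemma sum_antisym (f : 'I_n -> 'I_n -> Q) :
  (forall mu nu, f mu nu = - f nu mu) -> \sum_mu \sum_nu f mu nu = 0.
Proof.
move=> H; apply: (@eq_opp0 R); rewrite {1}exchange_big -sumrN; apply: eq_bigr => mu _.
by rewrite -sumrN; apply: eq_bigr => nu _; rewrite H.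
Qed.

Lemma covZ mu (r : R) X b : cov mu (fun c => r *: X c) b = r *: cov mu X b.
Proof. by rewrite /cov derZ brZr scalerBr. Qed.
Lemma covN mu X b : cov mu (fun c => - X c) b = - cov mu X b.
Proof. by rewrite /cov derN brNr opprB addrC opprK. Qed.
Lemma covD_fam mu X Y b : cov mu (fun c => X c + Y c) b = cov mu X b + cov mu Y b.
Proof. by rewrite /cov derD brDr; zmod. Qed.
Lemma cov_sum (I : finType) mu (X : I -> fam) b :
  cov mu (fun c => \sum_i X i c) b = \sum_i cov mu (X i) b.
Proof. by rewrite /cov der_sum br_sumr -sumrB. Qed.
Lemma covM mu x X b : par false x ->
  cov mu (fun c => x * X c) b = pd mu x * X b + x * cov mu X b.
Proof.
move=> Hx; rewrite /cov derM_even // br_mulr //; last exact: evf_A.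
by rewrite mulrBr addrA.
Qed.

(** By [ricci], exchanging the two covariant derivatives costs a bracket of [F] with itself, which
    vanishes; the summand is then antisymmetric. *)
Lemma div_div_gF b : \sum_mu \sum_nu cov mu (cov nu (fun c =>
  (eta nu * eta mu) *: gF nu mu c)) b = 0.
Proof.
apply: sum_antisym => mu nu.
have E (r : R) (m m' m1 m2 : 'I_n) : cov m (cov m' (fun c =>
  r *: gF m1 m2 c)) b = r *: cov m (cov m' (gF m1 m2)) b.
  by rewrite -covZ; apply: eq_cov => c; rewrite covZ.
rewrite !E [eta mu * _]mulrC -scalerN; congr (_ *: _).
have E2 : cov nu (cov mu (gF mu nu)) b = - cov nu (cov mu (gF nu mu)) b.
  rewrite -covN; apply: eq_cov => c; rewrite -covN; apply: eq_cov => d; exact: gF_anti.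
rewrite E2 opprK; apply/eqP; rewrite -subr_eq0 ricci; last exact: evf_F.
apply/eqP; rewrite (@eq_br _ _ (fun c => - gF nu mu c) (gF nu mu)) //; last exact: gF_anti.
rewrite brNl opprK; apply: (@eq_opp0 R); apply: brC; exact: evf_F.
Qed.

(** * Symmetries of the 3-form field strength, Noether identity and nilpotency *)

Lemma low_gF_anti mu nu a : low (gF mu nu) a = - low (gF nu mu) a.
Proof. by rewrite /low -sumrN; apply: eq_bigr => b _; rewrite gF_anti scalerN. Qed.

Lemma AC mu nu a b : gA mu a * gA nu b = gA nu b * gA mu a.
Proof. exact: even_comm (evf_A mu a) (evf_A nu b). Qed.

Lemma gHA_anti mu nu rho : gHA mu nu rho = - gHA mu rho nu.
Proof.
rewrite /gHA -sumrN; apply: eq_bigr => a _; rewrite exchange_big -sumrN; apply: eq_bigr => b _ /=.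
rewrite -sumrN; apply: eq_bigr => c _; rewrite Clo23 scaleNr; congr (- (_ *: (_ * _))).
exact: AC.
Qed.

Lemma Clo_cyc a b c : Clo C k a b c = Clo C k b c a.
Proof. by rewrite Clo12 Clo23 opprK. Qed.

Lemma gHA_cyc mu nu rho : gHA mu nu rho = gHA nu rho mu.
Proof.
rewrite /gHA exchange_big; apply: eq_bigr => b _ /=; rewrite exchange_big; apply: eq_bigr => c _.
apply: eq_bigr => a _; rewrite Clo_cyc; congr (_ *: _).
rewrite [RHS]mulrA; apply: even_comm (evf_A mu a) (parM (evf_A nu b) (evf_A rho c)).
Qed.

Lemma gH_anti mu nu rho : gH mu nu rho = - gH mu rho nu.
Proof.
rewrite /gH gHA_anti !opprD -!scalerN; congr (_ + _ + _ *: _).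
  rewrite /gH0 (asymC bB rho nu) (asymC bB rho mu) (asymC bB nu mu) !derN; zmod.
rewrite /gHF -sumrN; apply: eq_bigr => a _.
rewrite (low_gF_anti rho nu) (low_gF_anti rho mu) (low_gF_anti nu mu) !mulrN. zmod.
Qed.

Lemma gH_cyc mu nu rho : gH mu nu rho = gH nu rho mu.
Proof.
rewrite /gH gHA_cyc; congr (_ + _ + _ *: _); first by rewrite /gH0; zmod.
by rewrite /gHF; apply: eq_bigr => a _; zmod.
Qed.

Lemma gHup_anti mu nu rho : gHup mu nu rho = - gHup mu rho nu.
Proof. by rewrite /gHup gH_anti scalerN mulrAC. Qed.
Lemma gHup_cyc mu nu rho : gHup mu nu rho = gHup nu rho mu.
Proof. by rewrite /gHup gH_cyc; congr (_ *: _); rewrite -mulrA mulrC. Qed.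
Lemma gHup_anti12 mu nu rho : gHup mu nu rho = - gHup nu mu rho.
Proof. by rewrite gHup_cyc gHup_anti -gHup_cyc gHup_cyc gHup_cyc. Qed.

(** For increasing indices this is the definition; antisymmetry of [gHup] extends it to reversed and
    to equal indices. *)
Lemma dl_Bs mu nu : dl (asym bBs mu nu) = \sum_rho pd rho (gHup rho mu nu).
Proof.
rewrite /asym derB.
case: insubP => [q /= lt1 E1|ge1].
  case: insubP => [q' /= lt2 _|_]; first by move: (ltn_trans lt1 lt2); rewrite ltnn.
  by rewrite der0 subr0 dl_gf /= E1.
case: insubP => [q' /= lt2 E2|ge2].
  rewrite der0 sub0r dl_gf /= E2 -sumrN; apply: eq_bigr => rho _.
  by rewrite gHup_anti derN opprK.
rewrite !der0 subrr big1 // => rho _.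
suff -> : mu = nu.
  have -> : gHup rho nu nu = 0 by apply: (@eq_opp0 R); apply: gHup_anti.
  exact: der0.
move: ge1 ge2 => /= ge1 ge2; apply: ord_inj; apply/eqP.
by rewrite eqn_leq leqNgt ge2 /= leqNgt ge1.
Qed.

Lemma dl_low X a : dl (low X a) = low (fun b => dl (X b)) a.
Proof. by rewrite der_sum; apply: eq_bigr => b _; rewrite derZ. Qed.
Lemma dl_rai X a : dl (rai X a) = rai (fun b => dl (X b)) a.
Proof. by rewrite der_sum; apply: eq_bigr => b _; rewrite derZ. Qed.
Lemma dl_cov mu X a : dl (cov mu X a) = cov mu (fun b => dl (X b)) a.
Proof.
rewrite /cov derB dl_pd; congr (_ - _); rewrite der_sum; apply: eq_bigr => b _.
rewrite der_sum; apply: eq_bigr => c _; rewrite derZ derM_even; last exact: evf_A.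
by rewrite (dl_field (hom_A _ _)) mul0r add0r.
Qed.

(** Cyclic symmetry of [H] makes three rearrangements of the sum equal, and their total is a
    contraction with the Bianchi identity. *)
Lemma gH_bianchi b :
  \sum_mu \sum_nu \sum_rho gHup mu nu rho * cov mu (gF nu rho) b = 0.
Proof.
set S := LHS; suff : S *+ 3 = 0.
  by move/eqP; rewrite -scaler_nat scaler_eq0 pnatr_eq0 /= => /eqP.
rewrite !mulrS mulr0n addr0.
have E1 : S = \sum_mu \sum_nu \sum_rho gHup mu nu rho * cov nu (gF rho mu) b.
  rewrite [RHS]exchange_big; apply: eq_bigr => mu _ /=; rewrite [RHS]exchange_big.
  by apply: eq_bigr => nu _; apply: eq_bigr => rho _; rewrite [in RHS]gHup_cyc.
have E2 : S = \sum_mu \sum_nu \sum_rho gHup mu nu rho * cov rho (gF mu nu) b.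
  rewrite E1 [RHS]exchange_big; apply: eq_bigr => mu _ /=; rewrite [RHS]exchange_big.
  by apply: eq_bigr => nu _; apply: eq_bigr => rho _; rewrite [in RHS]gHup_cyc.
rewrite {2}E1 {2}E2 addrA -!big_split big1 // => mu _ /=; rewrite -!big_split big1 // => nu _ /=.
rewrite -!big_split big1 // => rho _ /=.
by rewrite -!mulrDr bianchi mulr0.
Qed.

(* The Noether identity that makes [dl] square to zero on [C^*]. *)
Lemma noether b : (2 * lam) *: (\sum_mu \sum_nu (\sum_rho pd rho (gHup rho mu nu)) * gF mu nu b)
  = \sum_mu cov mu (gY mu) b.
Proof.
have E mu : cov mu (gY mu) b =
    \sum_nu cov mu (cov nu (fun c => (eta nu * eta mu) *: gF nu mu c)) b
    + (2 * lam) *: (\sum_nu \sum_rho pd mu (gHup mu nu rho) * gF nu rho b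
                    + \sum_nu \sum_rho gHup mu nu rho * cov mu (gF nu rho) b).
  rewrite covD_fam covZ !cov_sum; congr (_ + _ *: _).
  rewrite -big_split; apply: eq_bigr => nu _ /=.
  rewrite cov_sum -big_split; apply: eq_bigr => rho _ /=.
  by rewrite covM //; exact: (hom2_par (hom_Hup _ _ _)).
(* The Yang-Mills part drops by [div_div_gF]; [gH_bianchi] then leaves only the terms where the
   derivative hits [H]. *)
rewrite (eq_bigr _ (fun mu _ => E mu)) big_split /= div_div_gF add0r.
rewrite -scaler_sumr big_split /= gH_bianchi addr0.
congr (_ *: _).
under eq_bigr => mu _ do under eq_bigr => nu _ do rewrite mulr_suml.
under eq_bigr => mu _ do rewrite exchange_big.
rewrite exchange_big /=; apply: eq_bigr => rho _.
by apply: eq_bigr => mu _; apply: eq_bigr => nu _.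
Qed.

(** On [bAs] and [bBs] the value contains only fields; on [bCs] this is [noether]; on [betas] and
    [brhos] commuting derivatives are contracted with an antisymmetric tensor. *)
Lemma dl_gdelta t : dl (gdelta t) = 0.
Proof.
case: t => /=; try by intros; exact: der0.
- move=> a mu; exact: dl_field (hom_gdelta (bAs a mu)).
- move=> a; rewrite derB derZ.
  have -> : dl (\sum_mu \sum_nu asym bBs mu nu * low (gF mu nu) a) =
      \sum_mu \sum_nu (\sum_rho pd rho (gHup rho mu nu)) * low (gF mu nu) a.
    rewrite der_sum; apply: eq_bigr => mu _; rewrite der_sum; apply: eq_bigr => nu _.
    rewrite (derM _ _ (hom2_par (hom_Bs mu nu))) dl_Bs.
    by rewrite (dl_field (hom_low _ (hom_F _ _))) mulr0 scaler0 addr0.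
  have -> : dl (\sum_mu low (cov mu (rai (fun c => gf (bAs c mu)))) a) =
      \sum_mu low (cov mu (gY mu)) a.
    rewrite der_sum; apply: eq_bigr => mu _; rewrite dl_low; apply: eq_low => b.
    rewrite dl_cov; apply: eq_cov => c; rewrite dl_rai -[RHS]raiK.
    by apply: eq_bigr => d _; rewrite dl_gf.
  rewrite -low_sum -(eq_low _ noether) lowZ; apply/eqP; rewrite subr_eq0; apply/eqP.
  congr (_ *: _); rewrite low_sum; apply: eq_bigr => mu _; rewrite low_sum.
  by apply: eq_bigr => nu _; rewrite lowMl.
- move=> q; exact: dl_field (hom_gdelta (bBs q)).
- move=> mu; rewrite derN der_sum.
  under eq_bigr => nu _ do rewrite dl_pd dl_Bs der_sum.
  rewrite sum_antisym ?oppr0 // => nu rho.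
  by rewrite pdC gHup_anti12 !derN.
- rewrite derN der_sum; under eq_bigr => mu _ do rewrite dl_pd dl_gf /= derN der_sum -sumrN.
  rewrite sum_antisym ?oppr0 // => mu nu.
  by rewrite pdC asymC !derN.
Qed.

Lemma dl_dl x : dl (dl x) = 0.
Proof.
apply: der_sq0 => // -[t J|m]; last exact: der0.
by rewrite [sfun _ _]cl_delta_gen dl_pdI dl_gdelta linear0.
Qed.
End KoszulTate.

(** * Weights, contraction and acyclicity *)

Section Weights.
Variables (R : realType) (m N : nat).
Notation n := (m.+3).
Variables (C : 'I_N -> 'I_N -> 'I_N -> R) (k : 'M[R]_N) (lam : R).
Notation G := (gen n N).
Notation W := (word n N).
Notation Q := (Q R n N).
Notation X t J := (gx (Gf t J) : Q).
Implicit Types (g h : G) (u w : W) (v : nat) (x y z : Q) (J K : {ffun 'I_n -> nat}) (mu nu rho :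
  'I_n)
  (a b c d : 'I_N) (t : base n N) (q : pairlt n).
Notation fam := ('I_N -> Q).

Definition o0 : 'I_n := @Ordinal n 0 isT.
Definition o1 : 'I_n := @Ordinal n 1 isT.
Definition o2 : 'I_n := @Ordinal n 2 isT.

(* The numbers [cw], [fac] solve a finite list of strict inequalities: [wg] is constant on
   matched pairs of generators, and [delta g] is lighter than [g] up to its leading part.
   For instance [42 = 7 * 6] and [49 = 7 * 7] come from [d_0 d_1 A_1] and [d_0^2 A_i]. *)
Definition cw mu : nat := match val mu with 0 => 7 | 1 => 6 | 2 => 5 | _ => 4 end%N.
Definition cJ J : nat := \prod_mu cw mu ^ J mu.

Lemma cw_gt0 mu : (0 < cw mu)%N. Proof. by rewrite /cw; case: (val mu) => [|[|[|]]]. Qed.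
Lemma cw_le7 mu : (cw mu <= 7)%N. Proof. by rewrite /cw; case: (val mu) => [|[|[|]]]. Qed.
Lemma cw_le6 mu : mu != o0 -> (cw mu <= 6)%N.
Proof. by rewrite -val_eqE /cw /=; case: (nat_of_ord mu) => [|[|[|]]]. Qed.
Lemma cw_le5 mu : mu != o0 -> mu != o1 -> (cw mu <= 5)%N.
Proof. by rewrite -!val_eqE /cw /=; case: (nat_of_ord mu) => [|[|[|]]]. Qed.
Lemma cw_le4 mu : mu != o0 -> mu != o1 -> mu != o2 -> (cw mu <= 4)%N.
Proof. by rewrite -!val_eqE /cw /=; case: (nat_of_ord mu) => [|[|[|]]]. Qed.
Lemma cw0 : cw o0 = 7%N. Proof. by []. Qed.
Lemma cw1 : cw o1 = 6%N. Proof. by []. Qed.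
Lemma cJ_gt0 J : (0 < cJ J)%N.
Proof. by apply: prodn_gt0 => mu; rewrite expn_gt0 cw_gt0. Qed.
Lemma cJ_incr J mu : cJ (incr J mu) = (cJ J * cw mu)%N.
Proof.
rewrite /cJ (bigD1 mu) //= [in RHS](bigD1 mu) //= ffunE eqxx expnD expn1 mulnAC.
congr (_ * _ * _)%N; apply: eq_bigr => nu /negPf ne.
by rewrite ffunE ne addn0.
Qed.

(** Matched partners get equal weights. With [A] of weight 1, 49 = 7 * 7 belongs to [d_0^2 A_i] and
    42 = 7 * 6 to [d_0 d_1 A_1]. [B] gets 2 so that the lightest leading part in the differential of
    [B^*], namely [d_0 d_2 B_{12}] with 70 = 7 * 5 * 2, still exceeds the 56 = 7 * 8 of the
    Chern-Simons terms; likewise 84 = 7 * 6 * 2 and 98 = 7 * 7 * 2. Components taken up by a Noether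
    identity get one more than the bound on their differential, 50 = 49 + 1 and 99 = 98 + 1, whence
    350 = 7 * 50, 693 = 7 * 99, 594 = 6 * 99 and 4851 = 7 * 693. *)
Definition fac t J : nat :=
  match t with
  | bAs _ mu => if mu == o0 then (if J o0 == 0 then 42 else 50) else 49
  | bCs _ => 350
  | bB _ => 2
  | bBs q => let: (mu, nu) := val q in
      if mu != o0 then 98
      else if (J o0 != 0) || ((nu == o1) && (J o1 != 0)) then 99
      else if nu == o1 then 70 else 84
  | betas mu => if (mu == o0) && (J o0 == 0) then 594 else 693
  | brhos => 4851
  | _ => 1
  end%N.
(* [kap t] is the largest value of [fac t]: the resulting weight [wb] overestimates [wg]
   but behaves uniformly under derivatives, which suffices for the nonlinear terms. *)
Definition kap t : nat :=
  match t with
  | bAs _ _ => 50 | bCs _ => 350 | bB _ => 2 | bBs _ => 99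
  | betas _ => 693 | brhos => 4851 | _ => 1
  end%N.
Definition wg g : nat := if g is Gf t J then (cJ J * fac t J)%N else 0%N.
Definition wb g : nat := if g is Gf t J then (cJ J * kap t)%N else 0%N.

Lemma wgE t J : wg (Gf t J) = (cJ J * fac t J)%N. Proof. by []. Qed.
Lemma fac_le t J : (fac t J <= kap t)%N.
Proof.
by case: t => //= [_ mu|q|mu]; [do 2?case: ifP | case: (val q) => ? ?; do 3?case: ifP | case: ifP].
Qed.
Lemma wg_le_wb g : (wg g <= wb g)%N.
Proof. by case: g => [t J|//]; rewrite leq_mul2l fac_le orbT. Qed.

(** [LT] measures error terms, strictly and by the exact weight; [BD] is the working bound by the
    majorant, handed over to [LT] by [BD_LT]. *)
Definition LT (v : nat) x := span (fun w => wt wg w < v)%N x.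
Definition BD (v : nat) x := span (fun w => wt wb w <= v)%N x.

Lemma wt_leq (d d' : G -> nat) w : (forall g, (d g <= d' g)%N) -> (wt d w <= wt d' w)%N.
Proof. by move=> H; elim: w => [|g w IH] //; rewrite !wt_cons leq_add. Qed.

Lemma BD_LT v v' x : (v < v')%N -> BD v x -> LT v' x.
Proof.
move=> lt_v; apply: sub_span => w H; apply: leq_ltn_trans lt_v; apply: leq_trans H.
exact: wt_leq wg_le_wb.
Qed.
Lemma BD_mono v v' x : (v <= v')%N -> BD v x -> BD v' x.
Proof. by move=> le_v; apply: sub_span => w H; apply: leq_trans le_v. Qed.
Lemma LT_mono v v' x : (v <= v')%N -> LT v x -> LT v' x.
Proof. by move=> le_v; apply: sub_span => w H; apply: leq_trans le_v. Qed.
Lemma BDM v v' x y : BD v x -> BD v' y -> BD (v + v') (x * y).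
Proof. by apply: spanM => u w Hu Hw; rewrite wt_cat leq_add. Qed.
Lemma BD_gf t : BD (kap t) (gf R t).
Proof.
apply: span_mon; rewrite wt1 /= /cJ big1 ?mul1n // => mu _.
by rewrite ffunE expn0.
Qed.
Lemma LT_gx v g : (wg g < v)%N -> LT v (gx g).
Proof. by move=> H; apply: span_mon; rewrite wt1. Qed.

(** The derivative acts on one letter at a time and multiplies its [wb] by [cw mu]; the other
    letters only gain room, as [cw mu] is at least 1. *)
Lemma BD_pd v mu x : BD v x -> BD (v * cw mu) (pd mu x).
Proof.
apply: span_linear => w Hw.
have : span (fun u => wt wb u <= wt wb w * cw mu)%N (pd mu (mon w : Q)).
  apply: (@der_span_mon _ _ _ (Dt R N mu) (fun w u => wt wb u <= wt wb w * cw mu)%N) =>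
    [g|g u v'|g u v'].
  - case: g => [t J|i]; last exact: span0.
    by apply: span_mon; rewrite !wt1 /= cJ_incr mulnAC.
  - rewrite wt_cat wt1 wt_cons mulnDl => H; apply: leq_add => //.
    by rewrite leq_pmulr // cw_gt0.
  - rewrite !wt_cons mulnDl => H; apply: leq_add => //.
    by rewrite leq_pmulr // cw_gt0.
by apply: sub_span => u /leq_trans -> //; rewrite leq_mul2r Hw orbT.
Qed.
Lemma BD_pd7 v mu x : BD v x -> BD (v * 7) (pd mu x).
Proof. by move/(BD_pd mu); apply: BD_mono; rewrite leq_mul2l cw_le7 orbT. Qed.
Lemma BD_pdI v J x : BD v x -> BD (cJ J * v) (pdI J x).
Proof.
move=> Hx; elim/mindex_ind: J => [|J mu IH].
  by rewrite pdI0 /cJ big1 ?mul1n // => mu _; rewrite ffunE expn0.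
by rewrite pdI_incr cJ_incr mulnAC; apply: BD_pd.
Qed.
(** Reduces an estimate on all derivatives of an expression to one on the expression itself. *)
Lemma BD_pdI_LT v v' J x : (v < v')%N -> BD v x -> LT (cJ J * v') (pdI J x).
Proof. by move=> lt_v /(BD_pdI J); apply: BD_LT; rewrite ltn_pmul2l ?cJ_gt0. Qed.

Lemma BD_br v v' (Y Z : fam) a : (forall b, BD v (Y b)) -> (forall b, BD v' (Z b)) ->
  BD (v + v') (br C Y Z a).
Proof.
by move=> HY HZ; do 2!(apply: span_sum => ? _); apply: spanZ; apply: BDM; [apply: HY|apply: HZ].
Qed.
Lemma BD_low v (Y : fam) a : (forall b, BD v (Y b)) -> BD v (low k Y a).
Proof. by move=> HY; apply: span_sum => b _; apply: spanZ; apply: HY. Qed.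
Lemma BD_rai v (Y : fam) a : (forall b, BD v (Y b)) -> BD v (rai k Y a).
Proof. by move=> HY; apply: span_sum => b _; apply: spanZ; apply: HY. Qed.
Lemma BD_A mu a : BD 1 (gA R mu a). Proof. exact: (BD_gf (bA a mu)). Qed.
Lemma BD_AA mu nu a : BD 2 (br C (gA R mu) (gA R nu) a).
Proof. by apply: (@BD_br 1 1) => b; apply: BD_A. Qed.
Lemma BD_F mu nu a : BD 7 (gF C mu nu a).
Proof.
apply: spanB; first by apply: spanB; apply: (@BD_pd7 1); apply: BD_A.
by apply: BD_mono (BD_AA mu nu a).
Qed.
Lemma BD_asym v (mk : pairlt n -> base n N) mu nu :
  (forall q, kap (mk q) = v) -> BD v (asym R mk mu nu).
Proof.
by move=> H; apply: spanB; case: insub => [q|]; try exact: span0; rewrite -(H q); apply: BD_gf.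
Qed.

Definition gHn mu nu rho : Q :=
  (-2 * lam) *: gHA C k mu nu rho + (-2 * lam) *: gHF C k mu nu rho.
Lemma gH_split mu nu rho : gH C k lam mu nu rho = gH0 R N mu nu rho + gHn mu nu rho.
Proof. by rewrite /gH addrA. Qed.
Lemma BD_Hn mu nu rho : BD 8 (gHn mu nu rho).
Proof.
apply: spanD; apply: spanZ.
  do 3!(apply: span_sum => ? _); apply: spanZ.
  apply: (@BD_mono (1 + (1 + 1))) => //; apply: BDM; last apply: BDM; exact: BD_A.
apply: span_sum => a _.
by apply: spanD; first apply: spanD; apply: (@BDM 1 7); try exact: BD_A;
  apply: BD_low => b; apply: BD_F.
Qed.
Lemma BD_H0 mu nu rho : BD 14 (gH0 R N mu nu rho).
Proof.
by apply: spanD; first apply: spanD; apply: (@BD_pd7 2); apply: BD_asym.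
Qed.
Lemma BD_Hup mu nu rho : BD 14 (gHup C k lam mu nu rho).
Proof.
apply: spanZ; rewrite gH_split; apply: spanD; first exact: BD_H0.
exact: BD_mono (BD_Hn _ _ _).
Qed.

Lemma lt_cJ1 J nu f v : (cw nu * f < v)%N -> (cJ (incr J nu) * f < cJ J * v)%N.
Proof. by rewrite cJ_incr -mulnA ltn_pmul2l ?cJ_gt0. Qed.
Lemma lt_cJ2 J nu rho f v : (cw nu * cw rho * f < v)%N ->
  (cJ (incr (incr J nu) rho) * f < cJ J * v)%N.
Proof. by rewrite !cJ_incr -!mulnA ltn_pmul2l ?cJ_gt0 // !mulnA. Qed.

(** * Leading parts of the differential on generators *)

Lemma mink0 : mink R o0 = -1. Proof. by []. Qed.
Lemma mink1 mu : mu != o0 -> mink R mu = 1.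
Proof. by rewrite /mink -val_eqE /= => /negPf ->. Qed.

(** Derivatives of an antisymmetric tensor at arbitrary indices. Generators exist only for
    increasing pairs, so this is 0 or a generator up to sign. *)
Definition aX (mk : pairlt n -> base n N) mu nu J : Q := pdI J (asym R mk mu nu).

Lemma aX_anti mk mu nu J : aX mk mu nu J = - aX mk nu mu J.
Proof. by rewrite /aX asymC pdIN. Qed.
Lemma aX_diag mk mu J : aX mk mu mu J = 0.
Proof. by apply: (@eq_opp0 R); apply: aX_anti. Qed.

Lemma aX_lt mk mu nu J (lt_mn : (mu < nu)%N) :
  aX mk mu nu J = X (mk (Sub (mu, nu) lt_mn)) J.
Proof.
rewrite /aX /asym insubT insubN ?subr0 /= -?leqNgt ?(ltnW lt_mn) //.
by rewrite /gf pdI_gx.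
Qed.

Lemma aX_val mk q J : aX mk (val q).1 (val q).2 J = X (mk q) J.
Proof.
by case: q => -[mu nu] /= lt_mn; rewrite (aX_lt mk J lt_mn).
Qed.

Lemma pdI_pd_asym mk mu nu rho J : pdI J (pd rho (asym R mk mu nu)) = aX mk mu nu (incr J rho).
Proof. by rewrite /aX pdI_incr pdI_pd. Qed.

Lemma pdI_pd_gf t rho J : pdI J (pd rho (gf R t)) = X t (incr J rho).
Proof. by rewrite pdI_pd pdI_gx pd_gx. Qed.
Lemma pdI_pd2_gf t nu rho J : pdI J (pd rho (pd nu (gf R t))) = X t (incr (incr J nu) rho).
Proof. by rewrite !pdI_pd pdI_gx !pd_gx. Qed.

Lemma LT_aB v mu nu J : (cJ J * 2 < v)%N -> LT v (aX bB mu nu J).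
Proof. by move/BD_LT; apply; apply: BD_pdI; apply: BD_asym. Qed.

(** The hypothesis speaks of the unordered pair because [fac] is attached to the increasing one. *)
Lemma LT_aBs v mu nu J : (mu != nu -> forall q, [set (val q).1; (val q).2] = [set mu; nu] ->
  (cJ J * fac (bBs q) J < v)%N) -> LT v (aX bBs mu nu J).
Proof.
case: (ltngtP mu nu) => [lt_mn|lt_nm|/ord_inj->] H.
- rewrite (aX_lt _ _ lt_mn); apply: LT_gx; apply: H => //.
  by apply: contraTneq lt_mn => ->; rewrite ltnn.
- rewrite aX_anti (aX_lt _ _ lt_nm); apply: spanN; apply: LT_gx; apply: H => /=.
    by apply: contraTneq lt_nm => ->; rewrite ltnn.
  by rewrite setUC.
- by rewrite aX_diag; apply: span0.
Qed.

(** The Maxwell operator, the part of [gY] linear in [A]. In [gY_lin] the heaviest neglected term is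
    [H F], with 21 = 14 + 7. *)
Definition Ylin mu b : Q := \sum_nu (mink R nu * mink R mu) *:
  (pd nu (pd nu (gA R mu b)) - pd nu (pd mu (gA R nu b))).

Lemma gY_lin mu b : BD 21 (gY C k lam mu b - Ylin mu b).
Proof.
rewrite /gY /Ylin addrAC -sumrB; apply: spanD.
  apply: span_sum => nu _; rewrite covZ -scalerBr; apply: spanZ.
  rewrite /cov {1}/gF !derB.
  set x := pd nu (br _ _ _ _); set y := br _ _ (gF _ _ _) _.
  rewrite (_ : _ - _ - _ = - x - y); last by zmod.
  apply: spanB; first apply: spanN.
    by apply: (@BD_mono (2 * 7)) => //; apply: BD_pd7; apply: BD_AA.
  by apply: (@BD_mono (1 + 7)) => //; apply: BD_br => c; [apply: BD_A | apply: BD_F].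
apply: spanZ; do 2!(apply: span_sum => ? _).
by apply: (@BDM 14 7); [apply: BD_Hup | apply: BD_F].
Qed.

Lemma pdI_Ylin J mu b : pdI J (Ylin mu b) = \sum_nu (mink R nu * mink R mu) *:
  (X (bA b mu) (incr (incr J nu) nu) - X (bA b nu) (incr (incr J mu) nu)).
Proof.
rewrite pdI_sum; apply: eq_bigr => nu _.
by rewrite pdIZ pdIB !pdI_pd2_gf.
Qed.

(** The term [nu = 0] contributes [- d_0^2 A_mu]. Every other linear term carries at most one time
    derivative, hence weighs at most 7 * 6 < 49. *)
Lemma pdI_gY_space J mu b : mu != o0 ->
  LT (cJ J * 49) (pdI J (gY C k lam mu b) + X (bA b mu) (incr (incr J o0) o0)).
Proof.
move=> mu0; rewrite -[gY _ _ _ _ _](subrK (Ylin mu b)) pdID -addrA; apply: spanD.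
  by apply: BD_pdI_LT (gY_lin mu b).
rewrite pdI_Ylin (bigD1 o0) //= mink0 mink1 // mulr1 scaleN1r opprB.
set x := X (bA b o0) _; set y := X (bA b mu) _; set S := \sum_(_ | _) _.
rewrite (_ : _ - _ + _ + _ = x + S); last by zmod.
have c6 := cw_le6 mu0.
apply: spanD; first by apply: LT_gx; apply: lt_cJ2; rewrite /fac cw0; lia.
apply: span_sum => nu nu0; have c6' := cw_le6 nu0; apply: spanZ.
by apply: spanB; apply: LT_gx; apply: lt_cJ2; rewrite /fac; nia.
Qed.

(** The term [nu = 0] cancels, so no second time derivative occurs. From [nu = 1] comes
    [d_0 d_1 A_1] of weight 42, against 36 for [d_1^2 A_0] and at most 7 * 5 from the remaining
    directions. *)
Lemma pdI_gY_time J b :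
  LT (cJ J * 42) (pdI J (gY C k lam o0 b) - X (bA b o1) (incr (incr J o0) o1)).
Proof.
rewrite -[gY _ _ _ _ _](subrK (Ylin o0 b)) pdID -addrA; apply: spanD.
  by apply: BD_pdI_LT (gY_lin o0 b).
rewrite pdI_Ylin (bigD1 o0) //= subrr scaler0 add0r (bigD1 o1) //= mink0 mink1 //
  mul1r scaleN1r opprB.
set x := X (bA b o1) _; set y := X (bA b o0) _; set S := \sum_(_ | _) _.
rewrite (_ : _ - _ + _ - _ = S - y); last by zmod.
apply: spanB; last by apply: LT_gx; apply: lt_cJ2.
apply: span_sum => nu /andP[nu0 nu1]; have c5 := cw_le5 nu0 nu1; apply: spanZ.
by apply: spanB; apply: LT_gx; apply: lt_cJ2; rewrite /fac ?cw0; nia.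
Qed.

Hypothesis kU : k \in unitmx.
Notation dl := (der (@Dd R n N C k lam kU)).

Lemma pdI_low J (Y : fam) a : pdI J (low k Y a) = low k (fun b => pdI J (Y b)) a.
Proof. by rewrite pdI_sum; apply: eq_bigr => b _; rewrite pdIZ. Qed.
Lemma pd_low mu (Y : fam) a : pd mu (low k Y a) = low k (fun b => pd mu (Y b)) a.
Proof. by rewrite der_sum; apply: eq_bigr => b _; rewrite derZ. Qed.
Lemma lowN (Y : fam) a : low k (fun b => - Y b) a = - low k Y a.
Proof. by rewrite /low -sumrN; apply: eq_bigr => b _; rewrite scalerN. Qed.
Lemma LT_low v (Y : fam) a : (forall b, LT v (Y b)) -> LT v (low k Y a).
Proof. by move=> HY; apply: span_sum => b _; apply: spanZ; apply: HY. Qed.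

Lemma dl_As_space a mu J : mu != o0 -> LT (cJ J * 49)
  (dl (X (bAs a mu) J) + low k (fun b => X (bA b mu) (incr (incr J o0) o0)) a).
Proof.
move=> mu0; rewrite dl_gx pdI_low -lowD; apply: LT_low => b.
exact: pdI_gY_space.
Qed.

Lemma dl_As_time a J : LT (cJ J * 42)
  (dl (X (bAs a o0) J) - low k (fun b => X (bA b o1) (incr (incr J o0) o1)) a).
Proof.
rewrite dl_gx pdI_low -lowN -lowD; apply: LT_low => b.
exact: pdI_gY_time.
Qed.

(** A crude bound for [A^{*0}] carrying a time derivative: its partner is [C^*], so its own
    differential need only be negligible. *)
Lemma dl_As_all a mu J : LT (cJ J * 50) (dl (X (bAs a mu) J)).
Proof.
rewrite dl_gx; apply: (@BD_pdI_LT 49) => //; apply: BD_low => b.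
rewrite -[gY _ _ _ _ _](subrK (Ylin mu b)); apply: spanD.
  exact: BD_mono (gY_lin mu b).
apply: span_sum => nu _; apply: spanZ.
by apply: spanB; apply: (@BD_pd7 7); apply: (@BD_pd7 1); apply: BD_A.
Qed.

(** The leading [- d_0 A^{*0}] weighs 7 * 50, the spatial divergence at most 6 * 49, and the
    nonlinear terms at most 99 + 7. *)
Lemma dl_Cs a J : LT (cJ J * 350) (dl (X (bCs a) J) + X (bAs a o0) (incr J o0)).
Proof.
have HB : BD 106 (gdelta C k lam (bCs a) + \sum_mu pd mu (gf R (bAs a mu))).
  rewrite /= -addrA; apply: spanD.
    apply: spanZ; do 2!(apply: span_sum => ? _); apply: (@BDM 99 7); first exact: BD_asym.
    by apply: BD_low => b; apply: BD_F.
  rewrite addrC -sumrB; apply: span_sum => mu _.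
  set Z := fun c => gf R (bAs c mu).
  have -> : low k (cov C mu (rai k Z)) a =
      pd mu (gf R (bAs a mu)) - low k (br C (gA R mu) (rai k Z)) a.
    rewrite -[gf R _](lowK kU Z) pd_low -lowN -lowD; exact: eq_low.
  rewrite opprB addrC subrK; apply: BD_low => b.
  apply: (@BD_mono (1 + 50)) => //; apply: BD_br => c; first exact: BD_A.
  by apply: BD_rai => d; apply: (BD_gf (bAs d mu)).
rewrite dl_gx -[gdelta _ _ _ _](addrK (\sum_mu pd mu (gf R (bAs a mu)))) pdIB -addrA.
apply: spanD; first by apply: BD_pdI_LT HB.
rewrite pdI_sum (bigD1 o0) //= pdI_pd_gf opprD addrAC addNr add0r; apply: spanN.
apply: span_sum => mu mu0; rewrite pdI_pd_gf; apply: LT_gx; apply: lt_cJ1.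
by have := cw_le6 mu0; rewrite /fac (negPf mu0); lia.
Qed.

(** The terms of [d^J d_rho H_{rho mu nu}] linear in [B]. *)
Definition hB J rho mu nu : Q := aX bB mu nu (incr (incr J rho) rho)
  + aX bB nu rho (incr (incr J mu) rho) + aX bB rho mu (incr (incr J nu) rho).

Lemma hB_diag1 J mu nu : hB J mu mu nu = 0.
Proof. by rewrite /hB aX_diag addr0 (aX_anti _ nu) subrr. Qed.
Lemma hB_diag2 J mu nu : hB J nu mu nu = 0.
Proof. by rewrite /hB aX_diag addr0 (aX_anti _ nu) addrN. Qed.

Lemma dl_Bs_lin J mu nu : LT (cJ J * 57) (pdI J (\sum_rho pd rho (gHup C k lam rho mu nu))
  - \sum_rho (mink R rho * mink R mu * mink R nu) *: hB J rho mu nu).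
Proof.
rewrite pdI_sum -sumrB; apply: span_sum => rho _.
rewrite /gHup derZ pdIZ -scalerBr; apply: spanZ.
rewrite gH_split derD pdID addrAC; apply: spanD; last first.
  by apply: (@BD_pdI_LT 56) => //; apply: (@BD_pd7 8); apply: BD_Hn.
rewrite (_ : pdI J _ = hB J rho mu nu) ?subrr; first exact: span0.
by rewrite /gH0 2!derD 2!pdID /hB /aX !pdI_incr !pdI_pd.
Qed.

Lemma LT_hB J rho mu nu v : (cw rho * cw rho * 2 < v)%N -> (cw mu * cw rho * 2 < v)%N ->
  (cw nu * cw rho * 2 < v)%N -> LT (cJ J * v) (hB J rho mu nu).
Proof.
by move=> H1 H2 H3; apply: spanD; first apply: spanD; apply: LT_aB; apply: lt_cJ2.
Qed.

Hypothesis Canti : forall a b c, C a b c = - C a c b.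
Hypothesis Clo12 : forall a b c, Clo C k a b c = - Clo C k b a c.
Hypothesis Clo23 : forall a b c, Clo C k a b c = - Clo C k a c b.

Lemma dl_aBs mu nu J : dl (aX bBs mu nu J) = pdI J (\sum_rho pd rho (gHup C k lam rho mu nu)).
Proof. by rewrite /aX dl_pdI dl_Bs. Qed.

Lemma dl_Bs_split v mu nu J y : (57 <= v)%N ->
  LT (cJ J * v) (\sum_rho (mink R rho * mink R mu * mink R nu) *: hB J rho mu nu + y) ->
  LT (cJ J * v) (dl (aX bBs mu nu J) + y).
Proof.
move=> le_v H; rewrite dl_aBs; set S := \sum_rho _ in H; rewrite -[pdI J _](subrK S) -addrA.
apply: spanD => //; apply: LT_mono (dl_Bs_lin J mu nu).
by rewrite leq_mul2l le_v orbT.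
Qed.

(** Only [rho = 0] yields two time derivatives, with the sign of [mink o0]; all else weighs at most
    7 * 6 * 2. *)
Lemma dl_Bs_space mu nu J : mu != o0 -> nu != o0 ->
  LT (cJ J * 98) (dl (aX bBs mu nu J) + aX bB mu nu (incr (incr J o0) o0)).
Proof.
move=> mu0 nu0; apply: dl_Bs_split => //; have c6 := cw_le6 mu0; have c6' := cw_le6 nu0.
rewrite (bigD1 o0) //= mink0 !mink1 // !mulr1 scaleN1r addrAC; apply: spanD.
  rewrite /hB; set x := aX bB nu o0 _; set y := aX bB o0 mu _.
  rewrite (_ : - _ + _ = - x - y); last by zmod.
  by apply: spanB; try apply: spanN; apply: LT_aB; apply: lt_cJ2; rewrite cw0; lia.
apply: span_sum => rho rho0; apply: spanZ; have c6'' := cw_le6 rho0.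
by apply: LT_hB; nia.
Qed.

(** [H_{00 nu}] vanishes, so the leading term comes from [rho = 1]; the heaviest competitor is
    [d_1^2 B_{0 nu}], with 72 < 84. *)
Lemma dl_Bs_time nu J : nu != o0 -> nu != o1 ->
  LT (cJ J * 84) (dl (aX bBs o0 nu J) - aX bB o1 nu (incr (incr J o0) o1)).
Proof.
move=> nu0 nu1; apply: dl_Bs_split => //; have c5 := cw_le5 nu0 nu1.
rewrite (bigD1 o0) //= hB_diag1 scaler0 add0r (bigD1 o1) //= mink0 !mink1 // mul1r mulr1 scaleN1r.
rewrite addrAC; apply: spanD.
  rewrite /hB; set x := aX bB o0 nu (incr (incr J o1) o1);
    set y := aX bB o1 o0 (incr (incr J nu) o1).
  rewrite (aX_anti _ o1 nu) (_ : - _ - _ = - x - y); last by zmod.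
  by apply: spanB; try apply: spanN; apply: LT_aB; apply: lt_cJ2; rewrite cw1; lia.
apply: span_sum => rho /andP[rho0 rho1]; apply: spanZ; have c5' := cw_le5 rho0 rho1.
by apply: LT_hB; rewrite ?cw0; nia.
Qed.

(** Both [rho = 0] and [rho = 1] vanish by antisymmetry, so a third direction has to supply the
    leading term. The directions beyond it have [cw] at most 4, giving 7 * 4 * 2 < 70. *)
Lemma dl_Bs_time1 J :
  LT (cJ J * 70) (dl (aX bBs o0 o1 J) + aX bB o1 o2 (incr (incr J o0) o2)).
Proof.
apply: dl_Bs_split => //.
rewrite (bigD1 o0) //= hB_diag1 scaler0 add0r (bigD1 o1) //= hB_diag2 scaler0 add0r.
rewrite (bigD1 o2) //= mink0 !mink1 // mul1r mulr1 scaleN1r addrAC; apply: spanD.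
  rewrite /hB; set x := aX bB o0 o1 _; set y := aX bB o2 o0 _.
  rewrite (_ : - _ + _ = - x - y); last by zmod.
  by apply: spanB; try apply: spanN; apply: LT_aB; apply: lt_cJ2.
apply: span_sum => rho /andP[/andP[rho0 rho1] rho2]; apply: spanZ.
have c4 := cw_le4 rho0 rho1 rho2.
by apply: LT_hB; rewrite ?cw0 ?cw1; nia.
Qed.

Lemma dl_Bs_all mu nu J : LT (cJ J * 99) (dl (aX bBs mu nu J)).
Proof.
rewrite dl_aBs; apply: (@BD_pdI_LT 98) => //; apply: span_sum => rho _.
by apply: (@BD_pd7 14); apply: BD_Hup.
Qed.

Lemma dl_etas mu J : dl (X (betas mu) J) = - \sum_nu aX bBs nu mu (incr J nu).
Proof.
rewrite dl_gx /= pdIN pdI_sum; congr (- _); apply: eq_bigr => nu _.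
exact: pdI_pd_asym.
Qed.

Lemma dl_etas_space mu J : mu != o0 ->
  LT (cJ J * 693) (dl (X (betas mu) J) + aX bBs o0 mu (incr J o0)).
Proof.
move=> mu0; rewrite dl_etas (bigD1 o0) //= opprD addrAC addNr add0r; apply: spanN.
apply: span_sum => nu nu0; apply: LT_aBs => _ q Eq; apply: lt_cJ1.
have q0 : (val q).1 != o0.
  have : (val q).1 \in [set nu; mu] by rewrite -Eq !inE eqxx.
  by rewrite !inE => /orP[]/eqP->.
by have := cw_le6 nu0; rewrite /fac; case: (val q) q0 => q1 q2 /= ->; lia.
Qed.

Lemma pair_o0 q nu : [set (val q).1; (val q).2] = [set nu; o0] -> val q = (o0, nu).
Proof.
case: q => -[q1 q2] /= lt_q E.
have q2N0 : q2 != o0 by apply: contraTneq lt_q => ->.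
have : o0 \in [set q1; q2] by rewrite E !inE eqxx orbT.
rewrite !inE eq_sym (eq_sym o0 q2) (negPf q2N0) orbF => /eqP ->.
have : q2 \in [set nu; o0] by rewrite -E !inE eqxx orbT.
by rewrite !inE (negPf q2N0) orbF => /eqP ->.
Qed.

(** Without time derivatives [B^{*0 nu}] has only [fac] 84 for [nu] beyond 1, so these terms weigh
    at most 5 * 84, and [d_1 B^{*01}] with 6 * 99 leads. *)
Lemma dl_etas_time J : J o0 = 0%N ->
  LT (cJ J * 594) (dl (X (betas o0) J) - aX bBs o0 o1 (incr J o1)).
Proof.
move=> J0; rewrite dl_etas (bigD1 o0) //= aX_diag add0r (bigD1 o1) //=.
rewrite (aX_anti _ o1) opprD opprK addrAC subrr add0r; apply: spanN.
apply: span_sum => nu /andP[nu0 nu1]; apply: LT_aBs => _ q /pair_o0 Eq; apply: lt_cJ1.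
have nu0' : (o0 == nu) = false by rewrite eq_sym (negPf nu0).
by have := cw_le5 nu0 nu1; rewrite /fac Eq eqxx /= ffunE J0 nu0' (negPf nu1) /=; lia.
Qed.

Lemma dl_etas_all J : LT (cJ J * 693) (dl (X (betas o0) J)).
Proof.
rewrite dl_etas; apply: spanN; rewrite (bigD1 o0) //= aX_diag add0r.
apply: span_sum => nu nu0; apply: LT_aBs => _ q _; apply: lt_cJ1.
by have := cw_le6 nu0; have := fac_le (bBs q) (incr J nu); rewrite [kap _]/=; nia.
Qed.

Lemma dl_rhos J : LT (cJ J * 4851) (dl (X brhos J) + X (betas o0) (incr J o0)).
Proof.
rewrite dl_gx /= pdIN pdI_sum (bigD1 o0) //= pdI_pd_gf opprD addrAC addNr add0r; apply: spanN.
apply: span_sum => mu mu0; rewrite pdI_pd_gf; apply: LT_gx; apply: lt_cJ1.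
by have := cw_le6 mu0; rewrite /fac (negPf mu0) /=; lia.
Qed.

(** * The contracting derivation *)

Definition decr J mu : {ffun 'I_n -> nat} := [ffun nu => (J nu - (nu == mu))%N].

Lemma decrK J mu : (0 < J mu)%N -> incr (decr J mu) mu = J.
Proof.
by move=> J0; apply/ffunP => nu; rewrite !ffunE subnK //; case: eqP => // ->.
Qed.
Lemma incrK J mu : decr (incr J mu) mu = J.
Proof. by apply/ffunP => nu; rewrite !ffunE addnK. Qed.
Lemma incr_eq J mu : incr J mu mu = (J mu).+1.
Proof. by rewrite ffunE eqxx addn1. Qed.
Lemma incr_neq J mu nu : nu != mu -> incr J mu nu = J nu.
Proof. by rewrite ffunE => /negPf ->; rewrite addn0. Qed.

(** Inverts the leading parts, with their signs: a target returns to its source and every other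
    generator goes to 0. The tests require [J] to contain the derivatives of the leading part, so
    [decr] never truncates, and make the cases disjoint: [J o0 == 1] sets the partners of time
    components apart from those carrying [d_0^2]. *)
Definition s_gen g : Q :=
  match g with
  | Gf (bA b mu) J =>
      if (mu != o0) && (1 < J o0)%N
      then - rai k (fun a => X (bAs a mu) (decr (decr J o0) o0)) b
      else if [&& mu == o1, J o0 == 1 & 0 < J o1]%N
      then rai k (fun a => X (bAs a o0) (decr (decr J o1) o0)) b else 0
  | Gf (bAs a mu) J =>
      if (mu == o0) && (0 < J o0)%N then - X (bCs a) (decr J o0) else 0
  | Gf (bB q) J =>
      if ((val q).1 != o0) && (1 < J o0)%N then - X (bBs q) (decr (decr J o0) o0)
      else if [&& (val q).1 == o1, J o0 == 1 & 0 < J o1]%N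
      then aX bBs o0 (val q).2 (decr (decr J o1) o0)
      else if [&& (val q).1 == o1, (val q).2 == o2, J o0 == 1, J o1 == 0 & 0 < J o2]%N
      then - aX bBs o0 o1 (decr (decr J o2) o0) else 0
  | Gf (bBs q) J =>
      if ((val q).1 == o0) && (0 < J o0)%N then - X (betas (val q).2) (decr J o0)
      else if [&& (val q).1 == o0, (val q).2 == o1 & 0 < J o1]%N
      then X (betas o0) (decr J o1) else 0
  | Gf (betas mu) J => if (mu == o0) && (0 < J o0)%N then - X brhos (decr J o0) else 0
  | _ => 0
  end.

(* [nug g] is 1 when [g] belongs to a matched pair. *)
Definition nug g : nat :=
  match g with
  | Gf (bA b mu) J => ((mu != o0) && (1 < J o0)) || [&& mu == o1, J o0 == 1 & 0 < J o1]
  | Gf (bB q) J => [|| ((val q).1 != o0) && (1 < J o0),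
                       [&& (val q).1 == o1, J o0 == 1 & 0 < J o1] |
                       [&& (val q).1 == o1, (val q).2 == o2, J o0 == 1, J o1 == 0 & 0 < J o2]]
  | Gf t J => (0 < base_agh t)
  | _ => 0
  end%N.

Definition raises g w := if w is [:: h] then
  [&& gen_odd h == ~~ gen_odd g, agh h == (agh g).+1 & wg h == wg g] else false.

Lemma raises_gx g h : [&& gen_odd h == ~~ gen_odd g, agh h == (agh g).+1 & wg h == wg g] ->
  span (raises g) (gx h : Q).
Proof. by move=> H; apply: span_mon. Qed.
Lemma raises_rai g (Y : fam) b : (forall a, span (raises g) (Y a)) -> span (raises g) (rai k Y b).
Proof. by move=> HY; apply: span_sum => a _; apply: spanZ; apply: HY. Qed.

(** Equality of weights is the arithmetic behind [fac]. [J] is first rewritten as a repeated [incr],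
    so that [cJ] and the tests inside [fac] can be evaluated. *)
Lemma raises_s_gen g : span (raises g) (s_gen g).
Proof.
case: g => [t J|i]; last exact: span0.
case: t => /=; try by intros; exact: span0.
- move=> b mu; case: ifP => [/andP[mu0 J0]|_].
    have E1 := decrK (ltnW J0); set J1 := decr J o0 in E1 *.
    have J10 : (0 < J1 o0)%N by rewrite -E1 incr_eq in J0.
    have E2 := decrK J10; set J2 := decr J1 o0 in E2 *.
    rewrite -E1 -E2; apply: spanN; apply: raises_rai => a; apply: raises_gx.
    by rewrite /= (negPf mu0) !cJ_incr -!mulnA.
  case: ifP => [/and3P[/eqP -> /eqP J0 J1]|_]; last exact: span0.
  have E1 := decrK J1; set K1 := decr J o1 in E1 *.
  have K10 : K1 o0 = 1%N by rewrite -J0 -E1 incr_neq.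
  have E2 : incr (decr K1 o0) o0 = K1 by apply: decrK; rewrite K10.
  set K2 := decr K1 o0 in E2 *.
  have K20 : K2 o0 = 0%N by move: K10; rewrite -E2 incr_eq => -[].
  rewrite -E1 -E2; apply: raises_rai => a; apply: raises_gx.
  by rewrite /= K20 !cJ_incr -!mulnA.
- move=> q; case: ifP => [/andP[mu0 J0]|_].
    have E1 := decrK (ltnW J0); set J1 := decr J o0 in E1 *.
    have J10 : (0 < J1 o0)%N by rewrite -E1 incr_eq in J0.
    have E2 := decrK J10; set J2 := decr J1 o0 in E2 *.
    rewrite -E1 -E2; apply: spanN; apply: raises_gx.
    by rewrite /=; case: (val q) mu0 => q1 q2 /= ->; rewrite !cJ_incr -!mulnA.
  case: q => -[q1 q2] /= lt_q.
  case: ifP => [/and3P[/eqP q1E /eqP J0 J1]|_].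
    subst q1; have E1 := decrK J1; set K1 := decr J o1 in E1 *.
    have K10 : K1 o0 = 1%N by rewrite -J0 -E1 incr_neq.
    have E2 : incr (decr K1 o0) o0 = K1 by apply: decrK; rewrite K10.
    set K2 := decr K1 o0 in E2 *.
    have K20 : K2 o0 = 0%N by move: K10; rewrite -E2 incr_eq => -[].
    have q20 : (o0 < q2)%N by apply: ltn_trans lt_q.
    have q21 : (q2 == o1) = false by apply: contraTF lt_q => /eqP ->.
    rewrite -E1 -E2 (aX_lt _ _ q20); apply: raises_gx.
    by rewrite /= K20 q21 !cJ_incr -!mulnA.
  case: ifP => [/and5P[/eqP q1E /eqP q2E /eqP J0 /eqP J1 J2]|_]; last exact: span0.
  subst q1 q2; have E1 := decrK J2; set K1 := decr J o2 in E1 *.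
  have K10 : K1 o0 = 1%N by rewrite -J0 -E1 incr_neq.
  have K11 : K1 o1 = 0%N by rewrite -J1 -E1 incr_neq.
  have E2 : incr (decr K1 o0) o0 = K1 by apply: decrK; rewrite K10.
  set K2 := decr K1 o0 in E2 *.
  have K20 : K2 o0 = 0%N by move: K10; rewrite -E2 incr_eq => -[].
  have K21 : K2 o1 = 0%N by rewrite -K11 -E2 incr_neq.
  have q20 : (o0 < o1)%N by [].
  rewrite -E1 -E2 (aX_lt _ _ q20); apply: spanN; apply: raises_gx.
  by rewrite /= K20 K21 !cJ_incr -!mulnA.
- move=> a mu; case: ifP => [/andP[/eqP -> J0]|_]; last exact: span0.
  have E1 := decrK J0; set J1 := decr J o0 in E1 *.
  rewrite -E1; apply: spanN; apply: raises_gx.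
  by rewrite /= incr_eq !cJ_incr -!mulnA.
- move=> q; case: ifP => [/andP[q0 J0]|].
    have E1 := decrK J0; set J1 := decr J o0 in E1 *.
    rewrite -E1; apply: spanN; apply: raises_gx.
    case: q q0 => -[q1 q2] /= lt_q /eqP q1E; subst q1.
    have q20 : (q2 == o0) = false by apply: contraTF lt_q => /eqP ->.
    by rewrite q20 incr_eq !cJ_incr -!mulnA.
  move/negbT; rewrite negb_and => H.
  case: ifP => [/and3P[/eqP q0 /eqP q1 J1]|_]; last exact: span0.
  have J0 : J o0 = 0%N by move: H; rewrite q0 eqxx /= -eqn0Ngt => /eqP.
  have E1 := decrK J1; set K1 := decr J o1 in E1 *.
  have K10 : K1 o0 = 0%N by rewrite -J0 -E1 incr_neq.
  rewrite -E1; apply: raises_gx; rewrite /=; case: (val q) q0 q1 => ? ? /= -> ->.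
  by rewrite /= K10 incr_eq orbT !cJ_incr -!mulnA.
- move=> mu; case: ifP => [/andP[/eqP -> J0]|_]; last exact: span0.
  have E1 := decrK J0; set J1 := decr J o0 in E1 *.
  rewrite -E1; apply: spanN; apply: raises_gx.
  by rewrite /= incr_eq !cJ_incr -!mulnA.
Qed.

Lemma s_gen_par g : par (true (+) gen_odd g) (s_gen g).
Proof.
apply: sub_span (raises_s_gen g) => -[|h [|? ?]] //= /and3P[/eqP odd_h _ _].
by rewrite wodd_cons odd_h addbF.
Qed.
Definition Ds := Sder s_gen_par.
Notation sd := (der Ds).

Lemma sd_LT v x : LT v x -> LT v (sd x).
Proof.
apply: span_linear => w Hw.
have : span (fun u => wt wg u == wt wg w) (sd (mon w)).
  apply: (@der_span_mon _ _ _ Ds (fun w u => wt wg u == wt wg w)) => [g|g u w'|g u w'].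
  - by apply: sub_span (raises_s_gen g) => -[|h [|? ?]] //= /and3P[_ _ /eqP E]; rewrite !wt1 E.
  - by rewrite wt_cat wt1 wt_cons => /eqP->.
  - by rewrite !wt_cons => /eqP->.
by apply: sub_span => u /eqP ->.
Qed.

Lemma sd_agh i x : span (fun w => wt (@agh n N) w == i) x ->
  span (fun w => wt (@agh n N) w == i.+1) (sd x).
Proof.
apply: span_linear => w /eqP <-.
apply: (@der_span_mon _ _ _ Ds (fun w u => wt (@agh n N) u == (wt (@agh n N) w).+1))
  => [g|g u w'|g u w'].
- by apply: sub_span (raises_s_gen g) => -[|h [|? ?]] //= /and3P[_ /eqP E _]; rewrite !wt1 E.
- by rewrite wt_cat wt1 wt_cons -addSn => /eqP->.
- by rewrite !wt_cons -addnS => /eqP->.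
Qed.

Lemma sd_gx g : sd (gx g) = s_gen g. Proof. exact: der_gx. Qed.
Lemma sd_low (Y : fam) a : sd (low k Y a) = low k (fun b => sd (Y b)) a.
Proof. by rewrite der_sum; apply: eq_bigr => b _; rewrite derZ. Qed.

Lemma sd_A_space b mu K : mu != o0 ->
  sd (X (bA b mu) (incr (incr K o0) o0)) = - rai k (fun a => X (bAs a mu) K) b.
Proof. by move=> mu0; rewrite sd_gx /= mu0 !incr_eq !incrK. Qed.
Lemma sd_A_time b K : K o0 = 0%N ->
  sd (X (bA b o1) (incr (incr K o0) o1)) = rai k (fun a => X (bAs a o0) K) b.
Proof.
by move=> K0; rewrite sd_gx /= incr_eq incr_neq // incr_eq K0 !incrK.
Qed.
Lemma sd_As a K : sd (X (bAs a o0) (incr K o0)) = - X (bCs a) K.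
Proof. by rewrite sd_gx /= incr_eq incrK. Qed.
Lemma sd_B_space q K : (val q).1 != o0 ->
  sd (X (bB q) (incr (incr K o0) o0)) = - X (bBs q) K.
Proof. by move=> q0; rewrite sd_gx /= q0 !incr_eq !incrK. Qed.
Lemma sd_B_time nu K : (1 < nu)%N -> K o0 = 0%N ->
  sd (aX bB o1 nu (incr (incr K o0) o1)) = aX bBs o0 nu K.
Proof.
move=> nu1 K0; have lt1 : (o1 < nu)%N by [].
by rewrite (aX_lt _ _ lt1) sd_gx /= incr_eq incr_neq // incr_eq K0 !incrK.
Qed.
Lemma sd_B_time1 K : K o0 = 0%N -> K o1 = 0%N ->
  sd (aX bB o1 o2 (incr (incr K o0) o2)) = - aX bBs o0 o1 K.
Proof.
move=> K0 K1; have lt1 : (o1 < o2)%N by [].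
by rewrite (aX_lt _ _ lt1) sd_gx /= incr_eq [incr _ o2 o0]incr_neq // [incr _ o2 o1]incr_neq //
  incr_eq incr_neq // K0 K1 !incrK.
Qed.
Lemma sd_Bs_space nu K : nu != o0 -> sd (aX bBs o0 nu (incr K o0)) = - X (betas nu) K.
Proof.
move=> nu0; have lt0 : (o0 < nu)%N by rewrite lt0n.
by rewrite (aX_lt _ _ lt0) sd_gx /= incr_eq incrK.
Qed.
Lemma sd_Bs_time K : K o0 = 0%N -> sd (aX bBs o0 o1 (incr K o1)) = X (betas o0) K.
Proof.
move=> K0; have lt0 : (o0 < o1)%N by [].
by rewrite (aX_lt _ _ lt0) sd_gx /= incr_eq incr_neq // K0 incrK.
Qed.
Lemma sd_etas K : sd (X (betas o0) (incr K o0)) = - X brhos K.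
Proof. by rewrite sd_gx /= incr_eq incrK. Qed.

(** * The Laplacian on generators *)

Definition lap x := dl (sd x) + sd (dl x).
Definition contracts g := LT (wg g) (lap (gx g) - (nug g)%:R *: gx g).

(** On a source [s] vanishes; in [s (delta g)] only the leading part [y] matters, because [s]
    preserves weight. *)
Lemma contracts_source g y : nug g = 1%N -> s_gen g = 0 -> LT (wg g) (dl (gx g) - y) ->
  sd y = gx g -> contracts g.
Proof.
move=> N1 s0 H Hy; rewrite /contracts /lap sd_gx s0 der0 add0r N1 scale1r -[Z in _ - Z]Hy -derB.
exact: sd_LT.
Qed.
(** On a target [delta (s g)] already reproduces [g]; the other half is negligible because [delta g]
    is lighter than [g] and [s] preserves weight. *)
Lemma contracts_target g : nug g = 1%N -> LT (wg g) (dl (s_gen g) - gx g) ->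
  LT (wg g) (dl (gx g)) -> contracts g.
Proof.
move=> N1 H1 H2; rewrite /contracts /lap sd_gx N1 scale1r addrAC; apply: spanD => //.
exact: sd_LT.
Qed.
Lemma contracts_inert g : nug g = 0%N -> s_gen g = 0 -> dl (gx g) = 0 -> contracts g.
Proof.
by move=> N0 s0 d0; rewrite /contracts /lap sd_gx s0 d0 N0 !der0 scale0r addr0 subr0; apply: span0.
Qed.

Lemma raiN (Y : fam) a : rai k (fun b => - Y b) a = - rai k Y a.
Proof. by rewrite /rai -sumrN; apply: eq_bigr => b _; rewrite scalerN. Qed.
Lemma raiD (Y Z : fam) a : rai k (fun b => Y b + Z b) a = rai k Y a + rai k Z a.
Proof. by rewrite /rai -big_split; apply: eq_bigr => b _; rewrite scalerDr. Qed.
Lemma LT_rai v (Y : fam) a : (forall b, LT v (Y b)) -> LT v (rai k Y a).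
Proof. by move=> HY; apply: span_sum => b _; apply: spanZ; apply: HY. Qed.

Lemma dl_A b mu J : dl (X (bA b mu) J) = 0.
Proof. by rewrite dl_gx /= linear0. Qed.
Lemma dl_B q J : dl (X (bB q) J) = 0.
Proof. by rewrite dl_gx /= linear0. Qed.

Lemma contracts_A b mu J : contracts (Gf (bA b mu) J).
Proof.
have [/andP[mu0 J0]|H1] := boolP ((mu != o0) && (1 < J o0)%N).
  have [K EJ] : exists K, J = incr (incr K o0) o0.
    have E1 := decrK (ltnW J0); exists (decr (decr J o0) o0).
    by rewrite decrK ?E1 //; move: J0; rewrite -{1}E1 incr_eq.
  apply: contracts_target; rewrite ?dl_A ?EJ; try exact: span0.
    by rewrite /= mu0 !incr_eq.
  rewrite -sd_gx sd_A_space // derN dl_rai.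
  rewrite -[Z in _ - Z](raiK kU (fun c => X (bA c mu) (incr (incr K o0) o0))).
  rewrite -opprD -raiD; apply: spanN; apply: LT_rai => a.
  rewrite /= !cJ_incr muln1 -mulnA; exact: dl_As_space.
have [/and3P[/eqP mu1 /eqP J0 J1]|H2] := boolP [&& mu == o1, J o0 == 1 & 0 < J o1]%N.
  have [K EJ K0] : exists2 K, J = incr (incr K o0) o1 & K o0 = 0%N.
    have E1 := decrK J1; have K10 : decr J o1 o0 = 1%N by rewrite -J0 -{2}E1 incr_neq.
    have E2 : incr (decr (decr J o1) o0) o0 = decr J o1 by apply: decrK; rewrite K10.
    exists (decr (decr J o1) o0); first by rewrite E2 E1.
    by apply/eqP; rewrite -eqSS -incr_eq E2 K10.
  subst mu; apply: contracts_target; rewrite ?dl_A ?EJ; try exact: span0.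
    by rewrite /= incr_eq incr_neq // incr_eq K0.
  rewrite -sd_gx sd_A_time // dl_rai.
  rewrite -[Z in _ - Z](raiK kU (fun c => X (bA c o1) (incr (incr K o0) o1))).
  rewrite -raiN -raiD; apply: LT_rai => a.
  rewrite /= !cJ_incr muln1 -mulnA; exact: dl_As_time.
by apply: contracts_inert; rewrite ?dl_A //= (negPf H1) (negPf H2).
Qed.

Lemma contracts_As a mu J : contracts (Gf (bAs a mu) J).
Proof.
have [->|mu0] := eqVneq mu o0; last first.
  apply: (@contracts_source _ (- low k (fun b => X (bA b mu) (incr (incr J o0) o0)) a)) => //.
  - by rewrite /= (negPf mu0).
  - by rewrite opprK /= (negPf mu0); apply: dl_As_space.
  - rewrite derN sd_low -lowN -[RHS](lowK kU (fun a => X (bAs a mu) J)); apply: eq_low => b.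
    by rewrite sd_A_space // opprK.
have [J0|J0] := posnP (J o0).
  apply: (@contracts_source _ (low k (fun b => X (bA b o1) (incr (incr J o0) o1)) a)) => //.
  - by rewrite /= J0.
  - by rewrite /= J0; apply: dl_As_time.
  - rewrite sd_low -[RHS](lowK kU (fun a => X (bAs a o0) J)); apply: eq_low => b.
    exact: sd_A_time.
(* With a time derivative, [A^{*0}] is no longer a source but the target of [C^*]. *)
have EJ := decrK J0; set K := decr J o0 in EJ; rewrite -EJ.
have E : wg (Gf (bAs a o0) (incr K o0)) = (cJ K * 350)%N by rewrite /= incr_eq cJ_incr -mulnA.
apply: contracts_target => //; last by rewrite /= incr_eq; apply: dl_As_all.
by rewrite -sd_gx sd_As E derN -opprD; apply: spanN; apply: dl_Cs.
Qed.

Lemma contracts_Cs a J : contracts (Gf (bCs a) J).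
Proof.
apply: (@contracts_source _ (- X (bAs a o0) (incr J o0))) => //.
- by rewrite opprK; apply: dl_Cs.
- by rewrite derN sd_As opprK.
Qed.

Lemma contracts_etas mu J : contracts (Gf (betas mu) J).
Proof.
have [->|mu0] := eqVneq mu o0; last first.
  apply: (@contracts_source _ (- aX bBs o0 mu (incr J o0))) => //.
  - by rewrite /= (negPf mu0).
  - by rewrite opprK /= (negPf mu0); apply: dl_etas_space.
  - by rewrite derN sd_Bs_space // opprK.
have [J0|J0] := posnP (J o0).
  apply: (@contracts_source _ (aX bBs o0 o1 (incr J o1))) => //.
  - by rewrite /= J0.
  - by rewrite /= J0; apply: dl_etas_time.
  - exact: sd_Bs_time.
have EJ := decrK J0; set K := decr J o0 in EJ; rewrite -EJ.
have E : wg (Gf (betas o0) (incr K o0)) = (cJ K * 4851)%N by rewrite /= incr_eq cJ_incr -mulnA.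
apply: contracts_target => //; last by rewrite /= incr_eq; apply: dl_etas_all.
by rewrite -sd_gx sd_etas E derN -opprD; apply: spanN; apply: dl_rhos.
Qed.

Lemma contracts_rhos J : contracts (Gf brhos J).
Proof.
apply: (@contracts_source _ (- X (betas o0) (incr J o0))) => //.
- by rewrite opprK; apply: dl_rhos.
- by rewrite derN sd_etas opprK.
Qed.

Lemma contracts_B q J : contracts (Gf (bB q) J).
Proof.
have [/andP[q0 J0]|H1] := boolP (((val q).1 != o0) && (1 < J o0)%N).
  have [K EJ] : exists K, J = incr (incr K o0) o0.
    have E1 := decrK (ltnW J0); exists (decr (decr J o0) o0).
    by rewrite decrK ?E1 //; move: J0; rewrite -{1}E1 incr_eq.
  apply: contracts_target; rewrite ?dl_B ?EJ; try exact: span0.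
    by rewrite /= q0 !incr_eq.
  rewrite -sd_gx sd_B_space // derN -opprD; apply: spanN; rewrite -!aX_val /= !cJ_incr -!mulnA.
  apply: dl_Bs_space => //; case: q q0 => -[q1 q2] /= lt_q _.
  by apply: contraTneq lt_q => ->.
have [/and3P[/eqP q1 /eqP J0 J1]|H2] := boolP [&& (val q).1 == o1, J o0 == 1 & 0 < J o1]%N.
  have [K EJ K0] : exists2 K, J = incr (incr K o0) o1 & K o0 = 0%N.
    have E1 := decrK J1; have K10 : decr J o1 o0 = 1%N by rewrite -J0 -{2}E1 incr_neq.
    have E2 : incr (decr (decr J o1) o0) o0 = decr J o1 by apply: decrK; rewrite K10.
    exists (decr (decr J o1) o0); first by rewrite E2 E1.
    by apply/eqP; rewrite -eqSS -incr_eq E2 K10.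
  have q2 : (1 < (val q).2)%N by have := valP q; rewrite q1.
  apply: contracts_target; rewrite ?dl_B ?EJ; try exact: span0.
    by rewrite /= q1 /= incr_eq incr_neq // incr_eq K0.
  rewrite -sd_gx -!aX_val q1 sd_B_time //= !cJ_incr -!mulnA.
  by apply: dl_Bs_time; apply: contraTneq q2 => ->.
have [/and5P[/eqP q1 /eqP q2 /eqP J0 /eqP J1 J2]|H3] :=
   boolP [&& (val q).1 == o1, (val q).2 == o2, J o0 == 1, J o1 == 0 & 0 < J o2]%N.
  have [K EJ [K0 K1]] : exists2 K, J = incr (incr K o0) o2 & K o0 = 0%N /\ K o1 = 0%N.
    have E1 := decrK J2; have K10 : decr J o2 o0 = 1%N by rewrite -J0 -{2}E1 incr_neq.
    have K11 : decr J o2 o1 = 0%N by rewrite -J1 -{2}E1 incr_neq.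
    have E2 : incr (decr (decr J o2) o0) o0 = decr J o2 by apply: decrK; rewrite K10.
    exists (decr (decr J o2) o0); first by rewrite E2 E1.
    split; first by apply/eqP; rewrite -eqSS -incr_eq E2 K10.
    by rewrite -K11 -[in RHS]E2 incr_neq.
  apply: contracts_target; rewrite ?dl_B ?EJ; try exact: span0.
    by rewrite /= q1 q2 /= incr_eq [incr _ o2 o0]incr_neq // [incr _ o2 o1]incr_neq //
      incr_eq incr_neq // K0 K1.
  rewrite -sd_gx -!aX_val q1 q2 sd_B_time1 //= !cJ_incr -!mulnA derN -opprD; apply: spanN.
  exact: dl_Bs_time1.
by apply: contracts_inert; rewrite ?dl_B //= (negPf H1) (negPf H2) (negPf H3).
Qed.

Lemma contracts_Bs q J : contracts (Gf (bBs q) J).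
Proof.
have lt_q := valP q; have Eq := aX_val bBs q J.
have [q10|q10] := eqVneq (val q).1 o0; last first.
  have q20 : (val q).2 != o0 by apply: contraTneq lt_q => ->.
  apply: (@contracts_source _ (- X (bB q) (incr (incr J o0) o0))) => //.
  - by rewrite /= (negPf q10).
  - have -> : wg (Gf (bBs q) J) = (cJ J * 98)%N by rewrite /wg /fac; move: q10;
    case: (val q) => ? ? /= /negPf ->.
    by rewrite opprK -!aX_val; apply: dl_Bs_space.
  - by rewrite derN sd_B_space // opprK.
have q20 : (val q).2 != o0 by apply: contraTneq lt_q => ->.
have fE : fac (bBs q) J = if (J o0 != 0%N) || (((val q).2 == o1) && (J o1 != 0%N)) then 99%N
      else if (val q).2 == o1 then 70%N else 84%N.
  by rewrite /fac; move: q10; case: (val q) => ? ? /= ->.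
rewrite q10 in Eq.
(* With a time derivative, [B^{*0 nu}] is the target of [eta^{*nu}]. *)
have [J0|J0] := posnP (J o0); last first.
  have EJ := decrK J0; set K := decr J o0 in EJ.
  have E : wg (Gf (bBs q) J) = (cJ K * 693)%N.
    by rewrite wgE fE -EJ incr_eq cJ_incr -mulnA.
  apply: contracts_target => //.
    by rewrite -sd_gx E -Eq -EJ sd_Bs_space // derN -opprD; apply: spanN; apply: dl_etas_space.
  rewrite -Eq wgE fE -{2}EJ incr_eq /=; exact: dl_Bs_all.
have [q21|q21] := eqVneq (val q).2 o1; last first.
  apply: (@contracts_source _ (aX bB o1 (val q).2 (incr (incr J o0) o1))) => //.
  - by rewrite /= q10 (negPf q21) J0 ?andbF.
  - by rewrite -Eq wgE fE J0 (negPf q21); apply: dl_Bs_time.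
  - rewrite sd_B_time // ltn_neqAle eq_sym; move: q21; rewrite -val_eqE /= => -> /=.
    by rewrite lt0n.
rewrite q21 in Eq.
(* Without time derivatives, [d_1 B^{*01}] is the target of [eta^{*0}]. *)
have [J1|J1] := posnP (J o1); last first.
  have EJ := decrK J1; set K := decr J o1 in EJ.
  have K0 : K o0 = 0%N by rewrite -J0 -EJ incr_neq.
  have E : wg (Gf (bBs q) J) = (cJ K * 594)%N.
    by rewrite wgE fE q21 -EJ incr_eq orbT cJ_incr -mulnA.
  apply: contracts_target => //.
    by rewrite -sd_gx E -Eq -EJ sd_Bs_time //; apply: dl_etas_time.
  rewrite -Eq wgE fE q21 eqxx -!lt0n J1 orbT; exact: dl_Bs_all.
apply: (@contracts_source _ (- aX bB o1 o2 (incr (incr J o0) o2))) => //.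
- by rewrite /= q10 q21 J0 J1 /=.
- by rewrite opprK -Eq wgE fE q21 J0 J1; apply: dl_Bs_time1.
- by rewrite derN sd_B_time1 // opprK.
Qed.

Lemma contracts_all g : contracts g.
Proof.
case: g => [t J|i]; last first.
  by apply: contracts_inert => //; rewrite der_gx.
have H0 : dl (X t J) = pdI J (gdelta C k lam t) by rewrite dl_gx.
case: t H0 => [b mu|q|a|mu||a mu|a|q|mu|] H0.
- exact: contracts_A.
- exact: contracts_B.
- by apply: contracts_inert => //; rewrite H0 linear0.
- by apply: contracts_inert => //; rewrite H0 linear0.
- by apply: contracts_inert => //; rewrite H0 linear0.
- exact: contracts_As.
- exact: contracts_Cs.
- exact: contracts_Bs.
- exact: contracts_etas.
- exact: contracts_rhos.
Qed.

(** A graded commutator of two odd derivations, hence an even derivation: its behaviour on words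
    follows from [contracts_all]. *)
Lemma lapE x : lap x = brk (@Dd R n N C k lam kU) Ds x.
Proof. by rewrite /lap /brk /sgn /= expr1 scaleN1r opprK. Qed.

(** Eigenvalues of a derivation add over the letters of a word, and an error in one letter makes the
    whole word lighter. *)
Lemma lap_mon w : LT (wt wg w) (lap (mon w) - (wt nug w)%:R *: mon w).
Proof.
elim: w => [|g w IH].
  by rewrite mon_nil /lap !der1 !der0 addr0 scale0r subr0; apply: span0.
have := contracts_all g; rewrite /contracts !lapE in IH *; rewrite !wt_cons => Hg.
rewrite mon_cons brk_gxM /= scale1r natrD scalerDl.
set x := brk _ _ _ in Hg *; set y := brk _ _ _ in IH *.
clearbody x y.
have -> : x * mon w + gx g * y - ((nug g)%:R *: (gx g * mon w) + (wt nug w)%:R *: (gx g * mon w))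
   = (x - (nug g)%:R *: gx g) * mon w + gx g * (y - (wt nug w)%:R *: mon w).
  by rewrite mulrBl mulrBr -scalerAl -scalerAr opprD addrACA.
apply: spanD.
  apply: (@spanM _ _ _ (fun u => wt wg u < wg g)%N (pred1 w)) Hg _ => [u u' Hu /eqP->|].
    by rewrite wt_cat ltn_add2r.
  by apply: span_mon; rewrite /= eqxx.
apply: (@spanM _ _ _ (pred1 [:: g]) (fun u => wt wg u < wt wg w)%N) IH => [u u' /eqP-> Hu|].
  by rewrite wt_cons ltn_add2l.
by apply: span_mon; rewrite /= eqxx.
Qed.

(** * Descent on the weight and the number of matched letters *)

Hypothesis Cjac : forall a b c d,
  \sum_e (C a b e * C e c d + C a c e * C e d b + C a d e * C e b c) = 0.

(** Every antifield letter is matched. This is where positive antighost number enters. *)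
Lemma agh_nug w : (0 < wt (@agh n N) w)%N -> (0 < wt nug w)%N.
Proof.
elim: w => [|g w IH] //; rewrite !wt_cons !addn_gt0 => /orP[|/IH ->]; last by rewrite orbT.
by case: g => [[]|] //= *.
Qed.

(** Every generator other than [Gdx] weighs at least 1. The bound gives the inner induction its
    starting level. *)
Lemma nug_wg w : (wt nug w <= wt wg w)%N.
Proof.
apply: wt_leq => -[t J|//]; rewrite wgE.
have : (0 < cJ J * fac t J)%N.
  rewrite muln_gt0 cJ_gt0; case: t => //= [_ mu|q|mu]; do 3?case: ifP => // _.
  by case: (val q) => ? ?; do 3?case: ifP.
by apply: leq_trans; case: t => //= *; apply: leq_b1.
Qed.

(** The induction order: weight first, then the number of matched letters among words of top weight
    only. *)
Definition level (v l : nat) w : bool :=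
  (wt wg w < v)%N || ((wt wg w == v) && (wt nug w <= l)%N).

(** Up to lighter terms, top words with [l + 1] matched letters have eigenvalue [l + 1] and cancel,
    while those with fewer are merely rescaled. *)
Lemma level_step v l x : span (level v l.+1) x ->
  span (level v l) (x - l.+1%:R^-1 *: lap x).
Proof.
move: x; apply: span_ind => [|c w x Hw Hx].
  by rewrite lapE linear0 scaler0 subr0; apply: span0.
rewrite lapE linearP /= -!lapE scalerDr opprD addrACA; apply: spanD => //.
rewrite scale_swap -scalerBr; apply: spanZ => {c x Hx}.
have HL := lap_mon w; set N0 := wt nug w in HL.
have -> : mon w - l.+1%:R^-1 *: lap (mon w) =
   (1 - l.+1%:R^-1 * N0%:R) *: mon w - l.+1%:R^-1 *: (lap (mon w) - N0%:R *: mon w).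
  by rewrite scalerBl scale1r scalerBr scalerA opprB addrA subrK.
have le_v : (wt wg w <= v)%N by case/orP: Hw => [/ltnW|/andP[/eqP->]].
apply: spanB; last first.
  by apply: spanZ; apply: sub_span HL => u lt_u; rewrite /level (leq_trans lt_u).
case/orP: Hw => [lt_v|/andP[/eqP Ev le_l]].
  by apply: spanZ; apply: span_mon; rewrite /level lt_v.
have [E|ne] := eqVneq N0 l.+1.
  by rewrite E mulVf ?pnatr_eq0 // subrr scale0r; apply: span0.
apply: spanZ; apply: span_mon; rewrite /level Ev eqxx ltnn /=.
by rewrite -ltnS ltn_neqAle ne.
Qed.

Lemma dl_agh i x : span (fun w => wt (@agh n N) w == i.+1) x ->
  span (fun w => wt (@agh n N) w == i) (dl x).
Proof.
apply: span_linear => w /eqP Ew; apply: sub_span (dl_agh_mon C lam kU w) => u.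
by rewrite Ew eqSS.
Qed.

(** The two spans may be witnessed by different representatives, so the argument passes through
    coefficients, which requires predicates invariant under reordering. *)
Lemma spanI (S T : pred W) x : (forall u w, perm_eq u w -> S u = S w) ->
  (forall u w, perm_eq u w -> T u = T w) -> span S x -> span T x -> span (predI S T) x.
Proof.
move=> HS HT; elim/(@Q_ind R n N): x => p Hp Hq; apply: cl_support => w.
rewrite negb_and => /orP[]; [exact: (support_span HS Hp) | exact: (support_span HT Hq)].
Qed.

Lemma level_agh0 v i x : span (level v 0) x -> span (fun w => wt (@agh n N) w == i.+1) x ->
  LT v x.
Proof.
move=> H1 H2; apply: sub_span (spanI _ _ H1 H2) =>
  [w /andP[/orP[//|/andP[_ N0]] /eqP Ew]|u w|u w] /=.
- by move: N0; rewrite leqNgt agh_nug // Ew.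
- by move=> uw; rewrite /level !(wt_perm _ uw).
- by move=> uw; rewrite !(wt_perm _ uw).
Qed.

Theorem acyclic i x : span (fun w => wt (@agh n N) w == i.+1) x -> dl x = 0 ->
  exists2 y, span (fun w => wt (@agh n N) w == i.+2) y & x = dl y.
Proof.
have [v] : exists v, LT v x.
  elim/(@Q_span R n N): x => [|c w x [v Hv]]; first by exists 0%N; apply: span0.
  exists (v + (wt wg w).+1)%N; apply: spanD; last by apply: LT_mono Hv; rewrite leq_addr.
  by apply: spanZ; apply: span_mon; rewrite ltn_addl.
elim: v x => [|v IHv] x Hv Hi Hd.
  exists 0; first exact: span0.
  by rewrite der0; apply: span_pred0 Hv => w.
have : span (level v v) x.
  apply: sub_span Hv => w; rewrite ltnS leq_eqVlt => /orP[/eqP E|]; last by rewrite /level => ->.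
  by rewrite /level E eqxx ltnn /= -E nug_wg.
move: {2}v => l {Hv}; elim: l x Hi Hd => [|l IHl] x Hi Hd Hl.
  by apply: IHv => //; apply: level_agh0 Hl Hi.
(* On a cycle [lap] gives a boundary, so the corrected element is again a cycle, homologous to
   [x]. *)
have lapx : lap x = dl (sd x) by rewrite /lap Hd der0 addr0.
case: (IHl (x - l.+1%:R^-1 *: lap x)).
- by apply: spanB => //; apply: spanZ; rewrite lapx; apply: dl_agh; apply: sd_agh.
- by rewrite derB Hd derZ lapx (dl_dl _ _ Canti Cjac Clo12 Clo23) scaler0 subr0.
- exact: level_step.
move=> y Hy E; exists (y + l.+1%:R^-1 *: sd x).
  by apply: spanD => //; apply: spanZ; apply: sd_agh.
by rewrite derD derZ -lapx -E subrK.
Qed.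
End Weights.

Theorem theorem3p1 (R : realType) (n N : nat)
    (C : 'I_N -> 'I_N -> 'I_N -> R) (k : 'M[R]_N) (lam : R) :
  (3 <= n)%N ->
  lie_structure_constants C -> simple_lie C -> invariant_metric C k ->
  forall (i : nat) (a : Pelt R n N),
    (0 < i)%N -> has_agh i a ->
    (forall m, pcoef (delta C k lam a) m = 0) ->
    exists b : Pelt R n N, has_agh i.+1 b /\ peq a (delta C k lam b).
Proof.
(* Leaves [n = m + 3], so that the directions 0, 1, 2 exist, and antighost number [i + 1]. *)
case: n => [|[|[|m]]] // _ [Canti Cjac] _ [_ kU Clo12 Clo23] [|i] // a _ Ha Hd.
have Ha' : span (fun w => wt (@agh m.+3 N) w == i.+1) (cl a) by apply: cl_support.
have Hd' : der (@Dd R m.+3 N C k lam kU) (cl a) = 0.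
  by rewrite -cl_delta; apply/clP => w; rewrite Hd /pcoef big_nil.
have [y] := acyclic Canti Clo12 Clo23 Cjac Ha' Hd'.
elim/(@Q_ind R m.+3 N): y => b Hb E; exists b; split.
  by apply: support_span Hb => u w uw; rewrite (wt_perm _ uw).
by apply/clP; rewrite cl_delta.
Qed.
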